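(* Let $\kappa$ be an infinite cardinal. If there is a basis of families on $\kappa$, then there is a basis of families on the cardinal $2^\kappa$.
   Context: FAMILIES. A family on a set $I$ is a set of finite subsets of $I$, identified with a subset of $\{0,1\}^I$. It is compact if it is closed in $\{0,1\}^I$, and hereditary if it is closed under subsets. $\mathcal F\restriction A=\{s\in\mathcal F: s\subseteq A\}$. For a nonempty compact family $\mathcal F$ (a scattered compact space), $\mathrm{rk}(\mathcal F)$ is the largest ordinal $\alpha$ such that the Cantor–Bendixson derivative $\mathcal F^{(\alpha)}$ is nonempty, where $X^{(0)}=X$, $X^{(\alpha)}=\bigcap_{\beta<\alpha}(X^{(\beta)})'$ and $Y'$ is the set of accumulation points of $Y$ belonging to $Y$. A countable ordinal $\lambda\ge\omega$ is exp-indecomposable if $\beta^\gamma<\lambda$ (ordinal exponentiation) for all $\beta,\gamma<\lambda$. For $\alpha<\omega_1$, $\iota(\alpha)$ is the least exp-indecomposable ordinal $>\alpha$. For an infinite set $I$: the small rank of a compact family $\mathcal F$ on $I$ is $\mathrm{srk}(\mathcal F)=\min\{\mathrm{rk}(\mathcal F\restriction C): C\subseteq I\text{ infinite}\}$. A compact hereditary family $\mathcal F$ on $I$ is $\alpha$-homogeneous if either $\alpha=0$ and $\mathcal F=\{\emptyset\}$, or $1\le\alpha<\omega_1$, $[I]^{\le 1}\subseteq\mathcal F$ and $\alpha=\mathrm{srk}(\mathcal F)\le\mathrm{rk}(\mathcal F)<\iota(\alpha)$; it is homogeneous if this holds for some $\alpha<\omega_1$. $[I]^{\le n}$ is the family of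 subsets of $I$ of cardinality $\le n$, and $\mathcal F\sqcup\mathcal G=\{s\cup t:s\in\mathcal F,t\in\mathcal G\}$. UNIFORM FAMILIES. For a family $\mathcal F$ on $\omega$ let $\mathcal F_{\{n\}}=\{s: n<\min s\text{ (or }s=\emptyset),\ \{n\}\cup s\in\mathcal F\}$, and let $M/n=\{m\in M:m>n\}$. A family $\mathcal F$ on an infinite $M\subseteq\omega$ with $\emptyset\in\mathcal F$ is $\alpha$-uniform on $M$ ($\alpha<\omega_1$) if: $\mathcal F=\{\emptyset\}$ when $\alpha=0$; every $\mathcal F_{\{n\}}$, $n\in M$, is $\beta$-uniform on $M/n$ when $\alpha=\beta+1$; and every $\mathcal F_{\{n\}}$, $n\in M$, is $\alpha_n$-uniform on $M/n$ with $(\alpha_n)_{n\in M}$ an increasing sequence of ordinals below $\alpha$ with supremum $\alpha$ when $\alpha$ is limit. $\mathcal F$ is spreading if $\{m_0<\dots<m_k\}\in\mathcal F$ and $n_0<\dots<n_k$ with $m_i\le n_i$ for all $i$ imply $\{n_0,\dots,n_k\}\in\mathcal F$. $\mathfrak S$ is the collection of all hereditary, spreading, uniform families on $\omega$. BASES. Let $\mathcal F$ be a homogeneous family on $I$ and $\mathcal H$ a homogeneous family on $\omega$. A family $\mathcal G$ on $I$ is a multiplication of $\mathcal F$ by $\mathcal H$ if (M.1) $\mathcal G$ is homogeneous and $\iota(\mathrm{srk}(\mathcal G))=\iota(\mathrm{srk}(\mathcal F)\cdot\mathrm{srk}(\mathcal H))$; and (M.2) every sequence $(s_n)_{n<\omega}$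 in $\mathcal F$ has an infinite subsequence $(t_n)_n$ with $\bigcup_{n\in x}t_n\in\mathcal G$ for every $x\in\mathcal H$. A basis of families on $I$ is a pair $(\mathfrak B,\times)$ such that: (B.1) $\mathfrak B$ consists of homogeneous families on $I$, contains all $[I]^{\le n}$, and for every $\omega\le\alpha<\omega_1$ contains some $\mathcal F$ with $\mathrm{srk}(\mathcal F)=\alpha$; (B.2) $\mathfrak B$ is closed under $\cup$ and $\sqcup$, and if $\mathcal F\subseteq\mathcal G\in\mathfrak B$, $\mathcal F$ is homogeneous and $\iota(\mathrm{srk}(\mathcal F))=\iota(\mathrm{srk}(\mathcal G))$, then $\mathcal F\in\mathfrak B$; (B.3) $\times:\mathfrak B\times\mathfrak S\to\mathfrak B$ and $\mathcal F\times\mathcal H$ is a multiplication of $\mathcal F$ by $\mathcal H$ for all $\mathcal F\in\mathfrak B$, $\mathcal H\in\mathfrak S$. *)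

(* Defs.v *)
From mathcomp Require Import all_boot all_classical topology.

Set Implicit Arguments.
Unset Strict Implicit.
Unset Printing Implicit Defensive.

Local Open Scope classical_set_scope.
Local Open Scope card_scope.

(* Ordinals. [Mk f] is the least ordinal strictly above all the [f i]. An
   ordinal has many representatives, so equality of ordinals is [oeq]
   (written [~=o]), not Leibniz equality. *)
Inductive Ord : Type := Mk (A : Type) (f : A -> Ord).

Fixpoint ole (a b : Ord) : Prop :=
  match a, b with Mk A f, Mk B g => forall i, exists j, ole (f i) (g j) end.

Definition olt (a b : Ord) : Prop :=
  match b with Mk B g => exists j, ole a (g j) end.

Definition oeq (a b : Ord) : Prop := ole a b /\ ole b a.

Declare Scope ord_scope.
Delimit Scope ord_scope with ord.
Notation "a <=o b" := (ole a b) (at level 70, no associativity) : ord_scope.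
Notation "a <o b" := (olt a b) (at level 70, no associativity) : ord_scope.
Notation "a ~=o b" := (oeq a b) (at level 70, no associativity) : ord_scope.
Local Open Scope ord_scope.

Lemma ole_refl a : a <=o a.
Proof. by elim: a => A f IH /= i; exists i. Qed.

Lemma ole_trans b a c : a <=o b -> b <=o c -> a <=o c.
Proof.
elim: a b c => A f IH [B g] [C h] /= ab bc i.
have [j fg] := ab i; have [k gh] := bc j.
by exists k; apply: IH fg gh.
Qed.

Lemma ole_lt_trans b a c : a <=o b -> b <o c -> a <o c.
Proof. by case: c => C h ab [k bh]; exists k; apply: ole_trans ab bh. Qed.

Lemma olt_le_trans b a c : a <o b -> b <=o c -> a <o c.
Proof.
case: b => B g [j ag]; case: c => C h /(_ j) [k gh].
by exists k; apply: ole_trans ag gh.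
Qed.

Lemma olt_Mk A (f : A -> Ord) i : f i <o Mk f.
Proof. by exists i; apply: ole_refl. Qed.

Lemma ole_Mk A (f : A -> Ord) b : Mk f <=o b <-> forall i, f i <o b.
Proof. by case: b. Qed.

Lemma oltW a b : a <o b -> a <=o b.
Proof.
elim: a b => A f IH b ab; apply/ole_Mk => i.
case: b ab => B g [j fg]; exists j; apply: IH.
by apply: olt_le_trans fg; apply: olt_Mk.
Qed.

Lemma oleP a b : a <=o b <-> forall c, c <o a -> c <o b.
Proof.
split=> [ab c ca|]; first exact: olt_le_trans ca ab.
by case: a => A f H; apply/ole_Mk => i; apply: H; apply: olt_Mk.
Qed.

Lemma ole_total a b : a <=o b \/ b <o a.
Proof.
elim: a b => A f IH b.
have [H|/existsNP[i nfb]] := pselect (forall i, f i <o b).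
  by left; apply/ole_Mk.
right; case: b nfb => B g nfb; exists i; apply/ole_Mk => j.
by have [fg|//] := IH i (g j); case: nfb; exists j.
Qed.

Lemma olt_wf : well_founded olt.
Proof.
move=> a; suff: forall b, b <=o a -> Acc olt b by apply; apply: ole_refl.
elim: a => A f IH b bf; constructor=> c cb.
have [i ci] : c <o Mk f by apply: olt_le_trans cb bf.
exact: IH ci.
Qed.

Definition ozero : Ord := @Mk void (fun i => match i with end).
Definition osucc (a : Ord) : Ord := @Mk unit (fun _ => a).
Definition oone : Ord := osucc ozero.

Fixpoint ofin (n : nat) : Ord := if n is m.+1 then osucc (ofin m) else ozero.
Definition omega : Ord := Mk ofin.

Definition olimit (a : Ord) : Prop :=
  ozero <o a /\ forall b, b <o a -> osucc b <o a.

Definition oindex (a : Ord) : Type := match a with Mk A _ => A end.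
Definition osub (a : Ord) : oindex a -> Ord := match a with Mk _ f => f end.

Definition osup A (f : A -> Ord) : Ord :=
  @Mk {i : A & oindex (f i)} (fun p => osub (projT2 p)).

Definition omax (a b : Ord) : Ord := osup (fun c : bool => if c then a else b).

Definition is_osup (P : Ord -> Prop) (a : Ord) : Prop :=
  (forall b, P b -> b <=o a) /\
  (forall c, (forall b, P b -> b <=o c) -> a <=o c).

(* For ordinal arithmetic, the usual zero, successor and limit equations are
   [oadd0], [oaddS], [oadd_lim], and similarly for [omul] and [oexp]. *)
Fixpoint oadd (a b : Ord) : Ord :=
  match b with Mk B g => omax a (Mk (fun j => oadd a (g j))) end.

Fixpoint omul (a b : Ord) : Ord :=
  match b with Mk B g => osup (fun j => oadd (omul a (g j)) a) end.

Fixpoint oexp_pos (a b : Ord) : Ord :=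
  match b with
  | Mk B g => omax oone (osup (fun j => omul (oexp_pos a (g j)) a))
  end.

(* 0 ^ b is 1 for b = 0 and 0 for b > 0. *)
Definition oexp (a b : Ord) : Ord :=
  if `[< a ~=o ozero /\ ozero <o b >] then ozero else oexp_pos a b.

Lemma ole_sub a b : a <=o b <-> forall i : oindex a, osub i <o b.
Proof. by case: a => A f; apply: ole_Mk. Qed.

Lemma osup_le A (f : A -> Ord) b : osup f <=o b <-> forall i, f i <=o b.
Proof.
split=> [/ole_Mk H i|H].
  by apply/ole_sub => j; apply: (H (existT _ i j)).
by apply/ole_Mk => -[i j] /=; have /ole_sub := H i; apply.
Qed.

Lemma osup_ub A (f : A -> Ord) i : f i <=o osup f.
Proof. by have /osup_le := ole_refl (osup f); apply. Qed.

Lemma omax_le a b c : omax a b <=o c <-> a <=o c /\ b <=o c.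
Proof.
split=> [/osup_le H|[ac bc]]; first by split; [apply: (H true)|apply: (H false)].
by apply/osup_le => -[].
Qed.

Lemma omaxl a b : a <=o omax a b.
Proof. exact: (@osup_ub _ (fun c : bool => if c then a else b) true). Qed.

Lemma omaxr a b : b <=o omax a b.
Proof. exact: (@osup_ub _ (fun c : bool => if c then a else b) false). Qed.

Lemma olt_succ a : a <o osucc a.
Proof. by exists tt; apply: ole_refl. Qed.

Lemma osucc_le a b : osucc a <=o b <-> a <o b.
Proof. by split=> [/ole_Mk/(_ tt)|ab]; last apply/ole_Mk. Qed.

Lemma olt_succ_le a b : a <o osucc b <-> a <=o b.
Proof. by split=> [[]|ab]; last exists tt. Qed.

Lemma olimit_lub b : olimit b -> is_osup (fun c => c <o b) b.
Proof.
move=> [_ bS]; split=> [c|c H]; first exact: oltW.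
by apply/oleP => d /bS /H /osucc_le.
Qed.

Lemma oadd0 a : oadd a ozero ~=o a.
Proof. by split; [apply/omax_le; split; [apply: ole_refl|apply/ole_Mk => -[]]|apply: omaxl]. Qed.

Lemma oaddS a b : oadd a (osucc b) ~=o osucc (oadd a b).
Proof.
split; last exact: omaxr.
apply/omax_le; split; last by apply/ole_Mk => _; apply: olt_succ.
by apply: oltW; apply/olt_succ_le; case: b => B g; apply: omaxl.
Qed.

Lemma oadd_homo a b c : b <=o c -> oadd a b <=o oadd a c.
Proof.
elim: b c => B g IH [C h] bc; apply/omax_le; split; first exact: omaxl.
apply: ole_trans (omaxr _ _); apply/ole_Mk => j.
by have [k gh] := bc j; exists k; apply: IH.
Qed.

Lemma oadd_lim a b : olimit b -> is_osup (fun d => exists2 c, c <o b & oadd a c = d) (oadd a b).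
Proof.
move=> lb; split=> [_ [c cb <-]|d H]; first by apply: oadd_homo; apply: oltW.
case: b lb H => B g lb H; apply/omax_le; split.
  apply: ole_trans (H (oadd a ozero) _); first by case: (oadd0 a).
  by exists ozero => //; case: lb.
apply/ole_Mk => j; apply/osucc_le; have [+ _] := oaddS a (g j).
case: (oaddS a (g j)) => _ /ole_trans + _; apply; apply: H.
by exists (osucc (g j)) => //; apply: lb.2; apply: olt_Mk.
Qed.

Lemma omul0 a : omul a ozero ~=o ozero.
Proof. by split; [apply/osup_le => -[]|apply/ole_Mk => -[]]. Qed.

Lemma omulS a b : omul a (osucc b) ~=o oadd (omul a b) a.
Proof.
split; first by apply/osup_le => _; apply: ole_refl.
exact: (@osup_ub _ (fun _ : unit => oadd (omul a b) a) tt).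
Qed.

Lemma oadd_homol a b c : a <=o b -> oadd a c <=o oadd b c.
Proof.
move=> ab; elim: c => C h IH; apply/omax_le; split.
  exact: ole_trans ab (omaxl _ _).
by apply: ole_trans (omaxr _ _); move=> k; exists k.
Qed.

Lemma omul_homo a b c : b <=o c -> omul a b <=o omul a c.
Proof.
elim: b c => B g IH [C h] bc; apply/osup_le => j; have [k gh] := bc j.
apply: ole_trans (osup_ub (fun k => oadd (omul a (h k)) a) k).
by apply: oadd_homol; apply: IH.
Qed.

Lemma omul_lim a b : olimit b -> is_osup (fun d => exists2 c, c <o b & omul a c = d) (omul a b).
Proof.
move=> lb; split=> [_ [c cb <-]|d H]; first by apply: omul_homo; apply: oltW.
case: b lb H => B g lb H; apply/osup_le => j.
apply: ole_trans (omulS a (g j)).2 (H _ _).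
by exists (osucc (g j)) => //; apply: lb.2; apply: olt_Mk.
Qed.

Lemma omul_homol a b c : a <=o b -> omul a c <=o omul b c.
Proof.
move=> ab; elim: c => C h IH; apply/osup_le => k.
apply: ole_trans (osup_ub (fun k => oadd (omul b (h k)) b) k).
exact: ole_trans (oadd_homol _ (IH k)) (oadd_homo _ ab).
Qed.

Lemma oexp_pos_homo a b c : b <=o c -> oexp_pos a b <=o oexp_pos a c.
Proof.
elim: b c => B g IH [C h] bc; apply/omax_le; split; first exact: omaxl.
apply: ole_trans (omaxr _ _); apply/osup_le => j; have [k gh] := bc j.
apply: ole_trans (osup_ub (fun k => omul (oexp_pos a (h k)) a) k).
by apply: omul_homol; apply: IH.
Qed.

Lemma oexpE a b : ozero <o a -> oexp a b = oexp_pos a b.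
Proof.
move=> a0; rewrite /oexp; case: asboolP => // -[[az _] _].
by have [] := olt_le_trans a0 az.
Qed.

Lemma oexp0 a : oexp a ozero ~=o oone.
Proof.
rewrite /oexp; case: asboolP => [[_ []]//|_].
split; last exact: omaxl.
by apply/omax_le; split; [apply: ole_refl|apply/osup_le => -[]].
Qed.

Lemma oexp0l b : ozero <o b -> oexp ozero b = ozero.
Proof.
by move=> b0; rewrite /oexp; case: asboolP => // -[]; split=> //; split; apply: ole_refl.
Qed.

Lemma oexpS a b : ozero <o a -> oexp a (osucc b) ~=o omul (oexp a b) a.
Proof.
move=> a0; rewrite !oexpE //; split; last first.
  apply: ole_trans (omaxr _ _).
  exact: (@osup_ub _ (fun _ : unit => omul (oexp_pos a b) a) tt).
apply/omax_le; split; last by apply/osup_le => _; apply: ole_refl.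
have e1 : oone <=o oexp_pos a b by case: b => B g; apply: omaxl.
have a1 : oone <=o a by apply/osucc_le.
apply: ole_trans (omul_homol _ e1); apply: ole_trans (omul_homo _ a1).
apply: ole_trans (omulS _ _).2; apply: ole_trans (oaddS _ _).2.
by apply/osucc_le; apply/olt_succ_le; apply/ole_Mk => -[].
Qed.

Lemma oexp_lim a b : ozero <o a -> olimit b ->
  is_osup (fun d => exists2 c, c <o b & oexp a c = d) (oexp a b).
Proof.
move=> a0 lb; split=> [_ [c cb <-]|d H].
  by rewrite !oexpE //; apply: oexp_pos_homo; apply: oltW.
rewrite oexpE //; case: b lb H => B g lb H; apply/omax_le; split.
  apply: ole_trans (oexp0 a).2 (H _ _); exists ozero => //; exact: lb.1.
apply/osup_le => j; change (omul (oexp_pos a (g j)) a <=o d); rewrite -(oexpE _ a0).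
apply: ole_trans (oexpS (g j) a0).2 (H _ _).
by exists (osucc (g j)) => //; apply: lb.2; apply: olt_Mk.
Qed.

(* [a < omega_1]: the set of predecessors of [a] is countable. *)
Definition octbl (a : Ord) : Prop :=
  exists f : nat -> Ord, forall b, b <o a -> exists n, b ~=o f n.

(* Least and largest element of a set of ordinals, a representative being
   chosen; the value is [ozero] when there is none. *)
Definition is_least (P : Ord -> Prop) (a : Ord) : Prop :=
  P a /\ forall b, P b -> a <=o b.
Definition is_largest (P : Ord -> Prop) (a : Ord) : Prop :=
  P a /\ forall b, P b -> b <=o a.

Definition choose_ord (P : Ord -> Prop) : Ord :=
  if pselect (exists a, P a) is left h then projT1 (cid h) else ozero.

Definition oleast (P : Ord -> Prop) : Ord := choose_ord (is_least P).
Definition olargest (P : Ord -> Prop) : Ord := choose_ord (is_largest P).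

Lemma oleastP (P : Ord -> Prop) : (exists a, P a) -> is_least P (oleast P).
Proof.
move=> [a Pa]; rewrite /oleast /choose_ord; case: pselect => [h|[]].
  exact: projT2 (cid h).
elim/(well_founded_ind olt_wf): a Pa => a IH Pa.
have [[b [Pb ba]]|H] := pselect (exists b, P b /\ b <o a); first exact: IH Pb.
exists a; split=> // b Pb; have [//|ba] := ole_total a b.
by case: H; exists b.
Qed.

Lemma olargestP (P : Ord -> Prop) a : is_largest P a -> is_largest P (olargest P).
Proof.
move=> Pa; rewrite /olargest /choose_ord; case: pselect => [h|[]].
  exact: projT2 (cid h).
by exists a.
Qed.

Definition exp_indecomposable (l : Ord) : Prop :=
  [/\ octbl l, omega <=o l &
      forall b c, b <o l -> c <o l -> oexp b c <o l].

Definition iota_ord (a : Ord) : Ord :=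
  oleast (fun l => exp_indecomposable l /\ a <o l).

Definition derived (T : topologicalType) (Y : set T) : set T :=
  Y `&` limit_point Y.

(* Intersecting over the [f i] only, rather than over all ordinals below
   [Mk f], is enough because the derivatives decrease; [CB0] and [CB_rec] give
   the usual recursion. *)
Fixpoint CB (T : topologicalType) (X : set T) (a : Ord) : set T :=
  match a with
  | Mk A f => X `&` \bigcap_(i in [set: A]) derived (CB X (f i))
  end.

Lemma CB_anti (T : topologicalType) (X : set T) a b :
  a <=o b -> CB X b `<=` CB X a.
Proof.
elim: a b => A f IH [B g] /= ab x [Xx H]; split=> // i _.
have [j fg] := ab i; have [Cx Lx] := H j I.
split; first exact: IH fg _ Cx.
move=> U /Lx [y [yx Cy Uy]]; exists y; split=> //.
exact: IH fg _ Cy.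
Qed.

Lemma CB0 (T : topologicalType) (X : set T) : CB X ozero = X.
Proof. by apply/seteqP; split=> x; [case|split]. Qed.

Lemma CB_rec (T : topologicalType) (X : set T) a : ozero <o a ->
  CB X a = [set x | forall b, b <o a -> derived (CB X b) x].
Proof.
move=> a0; apply/seteqP; split=> x.
  move=> Cx b /osucc_le ba; have [_ H] := CB_anti ba Cx.
  exact: (H tt).
case: a a0 => A f a0 H; split; last by move=> i _; apply: H; apply: olt_Mk.
by have := H ozero a0; rewrite CB0 => -[].
Qed.

(* The members of a family are arbitrary subsets of [I] here; their finiteness
   is the predicate [finitary], part of [compact_family] and [family_on]. *)
Definition Family (I : Type) := set (set I).

Definition finitary (I : Type) (F : Family I) : Prop :=
  forall s, F s -> finite_set s.

(* The subset of {0,1}^I identified with [F]. *)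
Definition char_family (I : Type) (F : Family I) : set {ptws I -> bool} :=
  [set x : {ptws I -> bool} | F [set i | x i]].

Definition compact_family (I : Type) (F : Family I) : Prop :=
  finitary F /\ closed (char_family F).

Definition hereditary (I : Type) (F : Family I) : Prop :=
  forall s t, F s -> t `<=` s -> F t.

Definition frestrict (I : Type) (F : Family I) (A : set I) : Family I :=
  [set s | F s /\ s `<=` A].

Definition rk (I : Type) (F : Family I) : Ord :=
  olargest (fun a => CB (char_family F) a !=set0).

Definition srk (I : Type) (F : Family I) : Ord :=
  oleast (fun a => exists2 C : set I, infinite_set C & rk (frestrict F C) = a).

Definition subsets_le (I : Type) (n : nat) : Family I :=
  [set s | s #<= `I_n].
Arguments subsets_le : clear implicits.

Definition alpha_homogeneous (I : Type) (a : Ord) (F : Family I) : Prop :=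
  [/\ compact_family F, hereditary F &
      (a ~=o ozero /\ F = [set set0]) \/
      [/\ oone <=o a /\ octbl a, subsets_le I 1 `<=` F, a ~=o srk F,
          srk F <=o rk F & rk F <o iota_ord a]].

Definition homogeneous (I : Type) (F : Family I) : Prop :=
  exists a, octbl a /\ alpha_homogeneous a F.

Definition fjoin (I : Type) (F G : Family I) : Family I :=
  [set s `|` t | s in F & t in G].

Definition fsection (F : Family nat) (n : nat) : Family nat :=
  [set s | (forall m, s m -> n < m) /\ F (n |` s)].

Definition above (M : set nat) (n : nat) : set nat := [set m | M m /\ n < m].

Definition family_on (M : set nat) (F : Family nat) : Prop :=
  [/\ infinite_set M, finitary F & forall s, F s -> s `<=` M].

Inductive uniform_on : Ord -> set nat -> Family nat -> Prop :=
| uniform_zero a M F : family_on M F ->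
    a ~=o ozero -> F = [set set0] -> uniform_on a M F
| uniform_succ a b M F : family_on M F -> F set0 ->
    a ~=o osucc b ->
    (forall n, M n -> uniform_on b (above M n) (fsection F n)) ->
    uniform_on a M F
| uniform_lim a (c : nat -> Ord) M F : family_on M F -> F set0 ->
    olimit a ->
    (forall m n, M m -> M n -> m < n -> c m <o c n) ->
    (forall n, M n -> c n <o a) ->
    is_osup (fun b => exists2 n, M n & c n = b) a ->
    (forall n, M n -> uniform_on (c n) (above M n) (fsection F n)) ->
    uniform_on a M F.

Definition uniform_family (F : Family nat) : Prop :=
  exists a, octbl a /\ uniform_on a [set: nat] F.

Definition spreading (F : Family nat) : Prop :=
  forall (k : nat) (m n : 'I_k.+1 -> nat),
    (forall i j : 'I_k.+1, i < j -> m i < m j) ->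
    (forall i j : 'I_k.+1, i < j -> n i < n j) ->
    (forall i, m i <= n i) ->
    F (range m) -> F (range n).

Definition frakS : set (Family nat) :=
  [set H | [/\ hereditary H, spreading H & uniform_family H]].

Definition is_multiplication (I : Type)
    (F : Family I) (H : Family nat) (G : Family I) : Prop :=
  [/\ homogeneous G,
      iota_ord (srk G) ~=o iota_ord (omul (srk F) (srk H)) &
      forall s : nat -> set I, (forall n, F (s n)) ->
        exists phi : nat -> nat,
          (forall m n, m < n -> phi m < phi n) /\
          forall x, H x -> G (\bigcup_(n in x) s (phi n))].

(* [times] is a function B * frakS -> B; its values outside B * frakS are
   irrelevant. *)
Record is_basis (I : Type) (B : set (Family I))
    (times : Family I -> Family nat -> Family I) : Prop := IsBasis {
  basis_homogeneous : forall F, B F -> homogeneous F;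
  basis_subsets_le : forall n, B (subsets_le I n);
  basis_srk : forall a, omega <=o a -> octbl a ->
    exists F, B F /\ srk F ~=o a;
  basis_union : forall F G, B F -> B G -> B (F `|` G);
  basis_join : forall F G, B F -> B G -> B (fjoin F G);
  basis_sub : forall F G, F `<=` G -> B G -> homogeneous F ->
    iota_ord (srk F) ~=o iota_ord (srk G) -> B F;
  basis_times_closed : forall F H, B F -> frakS H -> B (times F H);
  basis_times : forall F H, B F -> frakS H ->
    is_multiplication F H (times F H)
}.

Definition has_basis (I : Type) : Prop :=
  exists (B : set (Family I)) (times : Family I -> Family nat -> Family I),
    is_basis B times.

(* Main.v *)
(* Order [K] well and view the elements of [K -> bool] as branches of the binary tree of
   height [K]; two branches split at the first level where they differ. A family [F] on
   [K] lifts to the family [tree_family F] of the finite sets [s] of branches such that,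
   for every [z] in [s], the levels where [z] splits from the other members of [s] form a
   member of [F].

   Small rank: every infinite set of branches contains a comb [x_0, x_1, ...], in which
   [x_m] and [x_n] split at [d_m] for [m < n], with [d_m] increasing, and on a comb the
   lift of [F] has rank at least that of [F] on the levels, and at most one more on the
   left ([1 + b]), which is absorbed when the rank is infinite.

   Rank: fix a branch [x] of [s]. The other members of [s] are grouped by the level where
   they split from [x]; each group lives in a tree family over a section of [F] of smaller
   rank, and the set of levels is in [F]. A lexicographic argument with natural sums
   bounds the rank by iterated exponentiation, hence below [iota (srk F)].

   Multiplication: given [s_n] in the lift of [F], take a nonprincipal ultrafilter and the
   tree of the nodes met by almost all [s_n]. It has finitely many maximal branches [b],
   since infinitely many would contain a comb, contradicting the compactness of [F]. After
   thinning, a member [z] of [s_m] splits from the other [s_n], up to one level, as one of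
   these [b] does, and the splitting levels of [b] and [s_n] form a member of [F] joined
   with at most one level: multiplying these finitely many sequences on [K] suffices. *)

Require Import Defs.
From mathcomp Require Import all_boot all_classical.
From mathcomp Require Import finmap topology.

Set Implicit Arguments.
Unset Strict Implicit.
Unset Printing Implicit Defensive.

Local Open Scope classical_set_scope.
Local Open Scope card_scope.
Local Open Scope ord_scope.

(** * Ordinal arithmetic *)

Lemma oltNge a b : a <o b <-> ~ b <=o a.
Proof.
split=> [ab ba|]; last by case: (ole_total b a).
have : a <o a := olt_le_trans ab ba.
by elim/(well_founded_ind olt_wf): a {ab ba} => c IH cc; exact: (IH _ cc cc).
Qed.

Lemma olt_irr a : ~ a <o a.
Proof. by move=> aa; apply: (oltNge a a).1 aa (ole_refl a). Qed.

Lemma oleNgt a b : a <=o b <-> ~ b <o a.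
Proof.
split=> [ab /oltNge|H]; first exact.
by apply: contrapT => /oltNge.
Qed.

Lemma olt_trans b a c : a <o b -> b <o c -> a <o c.
Proof. by move=> ab /oltW; apply: olt_le_trans. Qed.

Lemma ozero_le a : ozero <=o a.
Proof. by apply/ole_Mk => -[]. Qed.

Lemma olt_oone a : a <o oone -> a <=o ozero.
Proof. by case. Qed.

Lemma lt_osup A (f : A -> Ord) b : b <o osup f <-> exists i, b <o f i.
Proof.
split=> [H|[i bf]]; last exact: olt_le_trans bf (osup_ub f i).
apply: contrapT => /forallNP N; apply: (oltNge _ _).1 H _.
by apply/osup_le => i; apply/oleNgt.
Qed.

Lemma lt_omax a b c : c <o omax a b <-> c <o a \/ c <o b.
Proof.
split=> [/lt_osup [[]]|[ca|cb]]; [by left|by right| |].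
  exact: olt_le_trans ca (omaxl a b).
exact: olt_le_trans cb (omaxr a b).
Qed.

Lemma osucc_homo a b : a <=o b -> osucc a <=o osucc b.
Proof. by move=> ab _; exists tt. Qed.

Lemma oadd_ltr a b c : b <o c -> oadd a b <o oadd a c.
Proof.
move=> /osucc_le bc; apply/osucc_le.
exact: ole_trans (oaddS a b).2 (oadd_homo a bc).
Qed.

Lemma oadd_lel a b : a <=o oadd a b.
Proof. by case: b => B g; apply: omaxl. Qed.

Lemma oadd_ler a b : b <=o oadd a b.
Proof.
elim: b => B g IH; apply: ole_trans (omaxr _ _) => j; exists j; exact: IH.
Qed.

Lemma lt_oadd a b c : c <o oadd a b -> c <o a \/ exists2 b', b' <o b & c <=o oadd a b'.
Proof.
case: b => B g /lt_omax [|[j cj]]; first by left.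
by right; exists (g j) => //; apply: olt_Mk.
Qed.

Lemma lt_omul a b c : c <o omul a b -> exists2 b', b' <o b & c <o oadd (omul a b') a.
Proof. by case: b => B g /lt_osup [j cj]; exists (g j) => //; apply: olt_Mk. Qed.

Lemma omul_lt_add a b b' : b' <o b -> oadd (omul a b') a <=o omul a b.
Proof. by move=> /osucc_le bb; apply: ole_trans (omulS a b').2 (omul_homo a bb). Qed.

Lemma omul_ltr a b c : ozero <o a -> b <o c -> omul a b <o omul a c.
Proof.
move=> a0 bc; apply: olt_le_trans (omul_lt_add a bc).
by apply: ole_lt_trans (oadd0 _).2 _; apply: oadd_ltr.
Qed.

Lemma omul1 a : omul a oone ~=o a.
Proof.
split.
  apply: ole_trans (omulS a ozero).1 _.
  apply: ole_trans (oadd_homol a (omul0 a).1) _.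
  elim: a => A f IH; apply/omax_le; split; first exact: ozero_le.
  by move=> i; exists i.
exact: ole_trans (oadd_ler _ _) (omulS a ozero).2.
Qed.

Lemma mul1o a : a <=o omul oone a.
Proof.
apply/oleP; elim: a => A f IH c [i ci].
apply: ole_lt_trans ci _; apply: olt_le_trans (omul_lt_add oone (olt_Mk f i)).
apply: ole_lt_trans _ (oadd_ltr _ (olt_succ ozero)).
by apply: ole_trans _ (oadd0 _).2; apply/oleP; apply: IH.
Qed.

Lemma oexp_pos_ge1 a b : oone <=o oexp_pos a b.
Proof. by case: b => B g; apply: omaxl. Qed.

Lemma oexp_pos_gt0 a b : ozero <o oexp_pos a b.
Proof. by apply/osucc_le; apply: oexp_pos_ge1. Qed.

Lemma oexp_pos_step a b c : b <o c -> omul (oexp_pos a b) a <=o oexp_pos a c.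
Proof.
case: c => C h [k bh]; apply: ole_trans (omaxr _ _).
apply: ole_trans (osup_ub (fun j => omul (oexp_pos a (h j)) a) k).
by apply: omul_homol; apply: oexp_pos_homo.
Qed.

Lemma ofin_le m n : m <= n -> ofin m <=o ofin n.
Proof.
elim: n m => [|n IH] [|m] //= H; try exact: ozero_le.
by apply: osucc_homo; apply: IH.
Qed.

Lemma ofin_lt_omega n : ofin n <o omega.
Proof. exact: olt_Mk. Qed.

Lemma lt_omega a : a <o omega -> exists n, a <=o ofin n.
Proof. by []. Qed.

Lemma omega_gt1 : oone <o omega.
Proof. exact: (ofin_lt_omega 1). Qed.

Lemma oadd_fin m n : oadd (ofin m) (ofin n) <=o ofin (m + n).
Proof.
elim: n => [|n IH]; first by rewrite addn0; apply: (oadd0 _).1.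
by rewrite addnS; apply: ole_trans (oaddS _ _).1 _; apply: osucc_homo.
Qed.

Lemma omul_fin m n : omul (ofin m) (ofin n) <=o ofin (m * n).
Proof.
elim: n => [|n IH]; first by rewrite muln0; apply: (omul0 _).1.
rewrite mulnSr; apply: ole_trans (omulS _ _).1 _.
exact: ole_trans (oadd_homol _ IH) (oadd_fin _ _).
Qed.

(** The base is [m.+1] because [oexp_pos] takes the value 1 at base 0, where [expn] vanishes for
    positive exponents. *)
Lemma oexp_pos_fin m n : oexp_pos (ofin m) (ofin n) <=o ofin (expn m.+1 n).
Proof.
elim: n => [|n IH].
  by apply/omax_le; split; [apply: ole_refl|apply/osup_le => -[]].
apply/omax_le; split.
  by apply: (@ofin_le 1); rewrite expn_gt0.
apply/osup_le => _.
apply: ole_trans (omul_homol _ IH) _; apply: ole_trans (omul_fin _ _) _.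
by apply: ofin_le; rewrite expnSr leq_mul.
Qed.

Lemma oexp_pos_homol a a' b : a <=o a' -> oexp_pos a b <=o oexp_pos a' b.
Proof.
move=> aa; elim: b => B g IH; apply/omax_le; split; first exact: omaxl.
apply: ole_trans (omaxr _ _); apply/osup_le => j.
apply: ole_trans (osup_ub (fun k => omul (oexp_pos a' (g k)) a') j).
exact: ole_trans (omul_homol _ (IH j)) (omul_homo _ aa).
Qed.

Lemma oexp_le a b : oexp a b <=o oexp_pos a b.
Proof. by rewrite /oexp; case: asboolP => // _; [apply: ozero_le|apply: ole_refl]. Qed.

Lemma octbl_le a b : a <=o b -> octbl b -> octbl a.
Proof. by move=> ab [f fP]; exists f => c ca; apply: fP; apply: olt_le_trans ca ab. Qed.

Lemma omega_eq_fin a : a <o omega -> exists n, a ~=o ofin n.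
Proof.
move=> /lt_omega [n]; elim: n => [|n IH] an.
  by exists 0; split=> //; apply: ozero_le.
have [/IH//|na] := ole_total a (ofin n).
by exists n.+1; split=> //; apply/osucc_le.
Qed.

Lemma octbl_omega : octbl omega.
Proof. by exists ofin; apply: omega_eq_fin. Qed.

Lemma exp_indecomposable_omega : exp_indecomposable omega.
Proof.
split; [exact: octbl_omega|exact: ole_refl|move=> b c [m bm] [n cn]].
exists (expn m.+1 n); apply: ole_trans (oexp_le _ _) _.
apply: ole_trans (oexp_pos_homol _ bm) _; apply: ole_trans (oexp_pos_homo _ cn) _.
exact: oexp_pos_fin.
Qed.

(** * Closure of exp-indecomposable ordinals under sum, product and power *)

Section ExpIndecomposable.
Variables (l : Ord) (lE : exp_indecomposable l).

Lemma exp_indecomposable_gt0 : ozero <o l.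
Proof. by case: lE => _ wl _; apply: olt_le_trans wl; apply: (ofin_lt_omega 0). Qed.

(** The product is at most the square of [m], the maximum of 1, [a] and [b]; the 1 keeps the base
    positive, so that [oexp] agrees with [oexp_pos] there. *)
Lemma exp_indecomposable_mul a b : a <o l -> b <o l -> omul a b <o l.
Proof.
case: (lE) => _ wl expl.
have fl n : ofin n <o l by apply: olt_le_trans wl; apply: ofin_lt_omega.
move=> al bl; pose m := omax oone (omax a b).
have ml : m <o l.
  rewrite /m; have [ab|/oltW ba] := ole_total a b.
    have [ob|/oltW bo] := ole_total oone b.
      by apply: ole_lt_trans bl; apply/omax_le; split=> //; apply/omax_le; split=> //; apply: ole_refl.
    apply: ole_lt_trans (fl 1); apply/omax_le; split; first exact: ole_refl.
    by apply/omax_le; split=> //; apply: ole_trans ab bo.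
  have [ob|/oltW bo] := ole_total oone a.
    by apply: ole_lt_trans al; apply/omax_le; split=> //; apply/omax_le; split=> //; apply: ole_refl.
  apply: ole_lt_trans (fl 1); apply/omax_le; split; first exact: ole_refl.
  by apply/omax_le; split=> //; apply: ole_trans ba bo.
have am : a <=o m by apply: ole_trans (omaxr _ _); apply: omaxl.
have bm : b <=o m by apply: ole_trans (omaxr _ _); apply: omaxr.
have m0 : ozero <o m by apply/osucc_le; apply: omaxl.
apply: ole_lt_trans (expl _ _ ml (fl 2)); rewrite oexpE //.
apply: ole_trans (omul_homol _ am) _; apply: ole_trans (omul_homo _ bm) _.
apply: ole_trans (oexp_pos_step m (olt_succ (ofin 1))); apply: omul_homol.
apply: ole_trans (oexp_pos_step m (olt_succ (ofin 0))).
by apply: ole_trans (mul1o m) _; apply: omul_homol; apply: oexp_pos_ge1.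
Qed.

Lemma exp_indecomposable_add a b : a <o l -> b <o l -> oadd a b <o l.
Proof.
case: (lE) => _ wl expl.
have fl n : ofin n <o l by apply: olt_le_trans wl; apply: ofin_lt_omega.
move=> al bl.
have ml : omax a b <o l.
  have [ab|/oltW ba] := ole_total a b.
    by apply: ole_lt_trans bl; apply/omax_le; split=> //; apply: ole_refl.
  by apply: ole_lt_trans al; apply/omax_le; split=> //; apply: ole_refl.
apply: ole_lt_trans (exp_indecomposable_mul ml (fl 2)).
apply: ole_trans (omulS _ _).2.
apply: ole_trans (oadd_homo a (omaxr a b)) _; apply: oadd_homol.
exact: ole_trans (omaxl a b) (omul1 _).2.
Qed.

(** Raising the base to [a + 1] makes it positive, where [oexp] and [oexp_pos] coincide. *)
Lemma exp_indecomposable_exp a b : a <o l -> b <o l -> oexp_pos a b <o l.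
Proof.
case: (lE) => _ wl expl.
have fl n : ofin n <o l by apply: olt_le_trans wl; apply: ofin_lt_omega.
move=> al bl; apply: ole_lt_trans (oexp_pos_homol b (oadd_lel a oone)) _.
have a0 : ozero <o oadd a oone.
  by apply/osucc_le; apply: oadd_ler.
by rewrite -oexpE //; apply: expl => //; apply: exp_indecomposable_add => //; apply: (fl 1).
Qed.

Lemma exp_indecomposable_succ a : a <o l -> osucc a <o l.
Proof.
case: (lE) => _ wl expl.
move=> al; apply: (@ole_lt_trans (oadd a oone)).
  by apply: ole_trans (oaddS a ozero).2; apply: osucc_homo; apply: oadd_lel.
by apply: exp_indecomposable_add => //; apply: olt_le_trans wl; apply: (ofin_lt_omega 1).
Qed.

End ExpIndecomposable.

(* The Hessenberg (natural) sum. *)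
Fixpoint nadd (a : Ord) : Ord -> Ord :=
  match a with
  | Mk A f => fix nadd_a (b : Ord) : Ord :=
    match b with
    | Mk B g => @Mk (A + B)%type (fun k => match k with
        | inl i => nadd (f i) (Mk g)
        | inr j => nadd_a (g j) end)
    end
  end.

Lemma lt_nadd a b c : c <o nadd a b <->
  (exists2 a', a' <o a & c <=o nadd a' b) \/ (exists2 b', b' <o b & c <=o nadd a b').
Proof.
have mono : forall a a' b b', a <=o a' -> b <=o b' -> nadd a b <=o nadd a' b'.
  elim=> A f IHa [A' f'] b0; elim: b0 => B g IHb [B' g'] aa bb /=.
  case=> [i|j].
    by have [i' ff] := aa i; exists (inl i'); apply: IHa.
  by have [j' gg] := bb j; exists (inr j'); apply: IHb.
case: a b => A f [B g]; split.
  case=> -[i|j] /= ci.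
    by left; exists (f i) => //; apply: olt_Mk.
  by right; exists (g j) => //; apply: olt_Mk.
case=> -[d [i di] cd].
  by exists (inl i); apply: ole_trans cd (mono _ _ _ _ di (ole_refl _)).
by exists (inr i); apply: ole_trans cd (mono _ _ _ _ (ole_refl _) di).
Qed.

Lemma nadd_ltl a a' b : a <o a' -> nadd a b <o nadd a' b.
Proof. by move=> aa; apply/lt_nadd; left; exists a => //; apply: ole_refl. Qed.

Lemma nadd_ltr a b b' : b <o b' -> nadd a b <o nadd a b'.
Proof. by move=> bb; apply/lt_nadd; right; exists b => //; apply: ole_refl. Qed.

Lemma nadd_homo a a' b b' : a <=o a' -> b <=o b' -> nadd a b <=o nadd a' b'.
Proof.
elim: a a' b b' => A f IHa [A' f'] b; elim: b => B g IHb [B' g'] aa bb /=.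
case=> [i|j].
  by have [i' ff] := aa i; exists (inl i'); apply: IHa.
by have [j' gg] := bb j; exists (inr j'); apply: IHb.
Qed.

(** These are the powers of omega, the additively indecomposable ordinals. *)
Definition nadd_closed (t : Ord) : Prop :=
  ozero <o t /\ forall a b, a <o t -> b <o t -> nadd a b <o t.

Lemma nadd_fin m n : nadd (ofin m) (ofin n) <=o ofin (m + n).
Proof.
have [k] : exists k, k = m + n by eexists.
elim: k m n => [|k IH] m n e; rewrite -e.
  by case: m n e => [|m] [|n] // _ [[]|[]].
apply/oleP => c /lt_nadd [] [d].
  case: m e => [|m] e; first by case.
  move/olt_succ_le => dm cd; apply/olt_succ_le; apply: ole_trans cd _.
  have ek : k = m + n by case: e.
  by rewrite ek; apply: ole_trans (IH _ _ ek); apply: nadd_homo => //; apply: ole_refl.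
case: n e => [|n] e; first by case.
move/olt_succ_le => dm cd; apply/olt_succ_le; apply: ole_trans cd _.
have ek : k = m + n by move: e; rewrite addnS => -[].
by rewrite ek; apply: ole_trans (IH _ _ ek); apply: nadd_homo => //; apply: ole_refl.
Qed.

Lemma nadd_closed_omega : nadd_closed omega.
Proof.
split=> [|a b [m am] [n bn]]; first exact: (ofin_lt_omega 0).
by exists (m + n); apply: ole_trans (nadd_fin m n); apply: nadd_homo.
Qed.

Lemma lt_omul_decomp t x c : ozero <o t -> c <o omul t x ->
  exists xi eta, [/\ xi <o x, eta <o t & c <=o oadd (omul t xi) eta].
Proof.
move=> t0 /lt_omul [xi xix /lt_oadd [ct|[eta et ce]]].
  by exists xi, ozero; split=> //; apply: ole_trans (oltW ct) (oadd_lel _ _).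
by exists xi, eta.
Qed.

(** Natural sums act digitwise in base [t]: the remainders never carry, since their natural sum
    stays below [t]. The induction is on the value [p] of the left-hand side. *)
Lemma nadd_omul_decomp t xi eta xi' eta' : nadd_closed t -> eta <o t -> eta' <o t ->
  nadd (oadd (omul t xi) eta) (oadd (omul t xi') eta') <=o
  oadd (omul t (nadd xi xi')) (nadd eta eta').
Proof.
move=> [t0 tC].
have [p] : exists p, p = nadd (oadd (omul t xi) eta) (oadd (omul t xi') eta') by eexists.
elim/(well_founded_ind olt_wf): p xi eta xi' eta' => p IH xi eta xi' eta' ep et et'.
(* Lowering the sum of the quotients below [z] outweighs all remainders. *)
have step y e y' e' z : e <o t -> e' <o t ->
    nadd (oadd (omul t y) e) (oadd (omul t y') e') <o p ->
    nadd y y' <o z -> nadd (oadd (omul t y) e) (oadd (omul t y') e') <o omul t z.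
  move=> eT eT' lep yz; apply: ole_lt_trans (IH _ lep _ _ _ _ erefl eT eT') _.
  apply: olt_le_trans (omul_lt_add t yz); apply: oadd_ltr; exact: tC.
apply/oleP => c /lt_nadd [] [d dl cd].
  (* An ordinal below the first summand is bounded by one with a smaller quotient, or with the same
     quotient and a smaller remainder. *)
  have [e [y [eT dle ylt]]] : exists e y, [/\ e <o t, d <=o oadd (omul t y) e &
      oadd (omul t y) e <o oadd (omul t xi) eta /\ (y <o xi \/ (y = xi /\ e <o eta))].
    have [/(lt_omul_decomp t0) [y [e [yx eT de]]]|[e ee de]] := lt_oadd dl.
      exists e, y; split=> //; split; last by left.
      apply: olt_le_trans (oadd_lel _ _); apply: olt_le_trans (omul_lt_add t yx); exact: oadd_ltr.
    exists e, xi; split=> //; first exact: olt_trans ee et.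
    by split; [exact: oadd_ltr|right].
  case: ylt => lt1 ylt; apply: ole_lt_trans cd _.
  apply: ole_lt_trans (nadd_homo dle (ole_refl _)) _.
  have lep : nadd (oadd (omul t y) e) (oadd (omul t xi') eta') <o p.
    by rewrite ep; apply: nadd_ltl.
  case: ylt => [yx|[yx ee]].
    by apply: olt_le_trans (oadd_lel _ _); apply: step => //; apply: nadd_ltl.
  subst y; apply: ole_lt_trans (IH _ lep _ _ _ _ erefl eT et') _.
  by apply: oadd_ltr; apply: nadd_ltl.
have [e [y [eT dle ylt]]] : exists e y, [/\ e <o t, d <=o oadd (omul t y) e &
    oadd (omul t y) e <o oadd (omul t xi') eta' /\ (y <o xi' \/ (y = xi' /\ e <o eta'))].
  have [/(lt_omul_decomp t0) [y [e [yx eT de]]]|[e ee de]] := lt_oadd dl.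
    exists e, y; split=> //; split; last by left.
    apply: olt_le_trans (oadd_lel _ _); apply: olt_le_trans (omul_lt_add t yx); exact: oadd_ltr.
  exists e, xi'; split=> //; first exact: olt_trans ee et'.
  by split; [exact: oadd_ltr|right].
case: ylt => lt1 ylt; apply: ole_lt_trans cd _.
apply: ole_lt_trans (nadd_homo (ole_refl _) dle) _.
have lep : nadd (oadd (omul t xi) eta) (oadd (omul t y) e) <o p.
  by rewrite ep; apply: nadd_ltr.
case: ylt => [yx|[yx ee]].
  by apply: olt_le_trans (oadd_lel _ _); apply: step => //; apply: nadd_ltr.
subst y; apply: ole_lt_trans (IH _ lep _ _ _ _ erefl et eT) _.
by apply: oadd_ltr; apply: nadd_ltr.
Qed.

Lemma nadd_closed_mul t x : nadd_closed t -> nadd_closed x -> nadd_closed (omul t x).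
Proof.
move=> tC xC; have [t0 tN] := tC; have [x0 xN] := xC; split.
  apply: ole_lt_trans (omul0 t).2 _; exact: omul_ltr.
move=> a b /(lt_omul_decomp t0) [xi [eta [xx et ale]]] /(lt_omul_decomp t0) [xi' [eta' [xx' et' ble]]].
apply: ole_lt_trans (nadd_homo ale ble) _.
apply: ole_lt_trans (nadd_omul_decomp _ _ tC et et') _.
by apply: olt_le_trans (omul_lt_add t (xN _ _ xx xx')); apply: oadd_ltr; apply: tN.
Qed.

Lemma nadd_closed_exp x a : nadd_closed x -> nadd_closed (oexp_pos x a).
Proof.
move=> xC; elim: a => A f IH; split; first exact: oexp_pos_gt0.
pose T i := omul (oexp_pos x (f i)) x.
have TC i : nadd_closed (T i) by apply: nadd_closed_mul.
have TT i c : c <o T i -> c <o oexp_pos x (Mk f).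
  by move=> cT; apply/lt_omax; right; apply/lt_osup; exists i.
move=> a b /lt_omax [/olt_oone a0|/lt_osup [i ai]] /lt_omax [/olt_oone b0|/lt_osup [j bj]].
- apply: ole_lt_trans (nadd_homo a0 b0) _.
  by apply: ole_lt_trans (nadd_fin 0 0) _; apply: oexp_pos_gt0.
- by apply: (TT j); apply: (TC j).2 => //; apply: ole_lt_trans a0 (TC j).1.
- by apply: (TT i); apply: (TC i).2 => //; apply: ole_lt_trans b0 (TC i).1.
- have [ij|/oltW ji] := ole_total (T i) (T j).
    by apply: (TT j); apply: (TC j).2 => //; apply: olt_le_trans ai ij.
  by apply: (TT i); apply: (TC i).2 => //; apply: olt_le_trans bj ji.
Qed.

Lemma ole_omega_exp a : a <=o oexp_pos omega a.
Proof.
elim: a => A f IH; apply/ole_Mk => i.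
apply: ole_lt_trans (IH i) _.
apply: olt_le_trans (oexp_pos_step omega (olt_Mk f i)).
apply: ole_lt_trans (omul1 _).2 _; apply: omul_ltr; first exact: oexp_pos_gt0.
exact: omega_gt1.
Qed.

(** This absorbs the extra 1 on the left in the rank computed on a comb. *)
Lemma oadd1_le a : omega <=o a -> oadd oone a <=o a.
Proof.
elim: a => A f IH wa; apply/omax_le; split.
  by apply: ole_trans wa; apply: oltW; apply: omega_gt1.
apply/ole_Mk => i; have [wi|iw] := ole_total omega (f i).
  exact: ole_lt_trans (IH i wi) (olt_Mk f i).
have [n fn] := lt_omega iw.
apply: olt_le_trans wa; exists n.+1.
by apply: ole_trans (oadd_homo _ fn) _; apply: ole_trans (oadd_fin 1 n) _; apply: ole_refl.
Qed.

(** The witness [l] rules out the default value [ozero] of [oleast]; it is either [omega] or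
    supplied by homogeneity. *)
Lemma iota_ordP a l : exp_indecomposable l -> a <o l ->
  [/\ exp_indecomposable (iota_ord a), a <o iota_ord a &
      forall m, exp_indecomposable m -> a <o m -> iota_ord a <=o m].
Proof.
move=> lE al.
have [[iE ai] H] := @oleastP (fun l => exp_indecomposable l /\ a <o l)
  (ex_intro _ l (conj lE al)).
by split=> // m mE am; apply: H.
Qed.

Lemma iota_ord_eq a b : (forall m, exp_indecomposable m -> a <o m <-> b <o m) ->
  iota_ord a = iota_ord b.
Proof.
move=> H; rewrite /iota_ord; congr oleast; apply/funext => l; apply/propext.
by split=> -[lE al]; split=> //; apply/H.
Qed.

(** * Finite sets and pointwise convergence *)

Lemma setU1_id (T : Type) (x : T) (A : set T) : A x -> x |` A = A.
Proof. by move=> Ax; apply/seteqP; split=> [y [->|]//|y Ay]; right. Qed.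

Lemma setU1D1 (T : Type) (x : T) (A : set T) : A x -> x |` (A `\ x) = A.
Proof.
move=> Ax; apply/seteqP; split=> [y [->//|[]//]|y Ay].
by have [->|nyx] := pselect (y = x); [left|right].
Qed.

Lemma finite_setU1 (T : Type) (x : T) (A : set T) : finite_set A -> finite_set (x |` A).
Proof. by move=> fA; rewrite finite_setU; split=> //; apply: finite_set1. Qed.

Lemma finite_set_rect (T : Type) (P : set T -> Prop) :
  P set0 -> (forall x A, finite_set A -> ~ A x -> P A -> P (x |` A)) ->
  forall A, finite_set A -> P A.
Proof.
elim/Peq: T => T in P *; move=> P0 PS A /finite_seqP [l ->].
elim: l => [|x l IH]; first by rewrite (_ : [set` _] = set0) //; apply/seteqP; split.
have -> : [set` x :: l] = x |` [set` l].
  apply/seteqP; split=> y /=; rewrite inE; first by case/orP=> [/eqP|]; [left|right].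
  by case=> [->|->]; rewrite ?eqxx ?orbT.
have [xl|nxl] := pselect ([set` l] x); first by rewrite setU1_id.
by apply: PS => //; apply: finite_seq.
Qed.

Lemma infinite_setDfin (T : Type) (A B : set T) :
  infinite_set A -> finite_set B -> infinite_set (A `\` B).
Proof.
move=> Ai Bf ABf; apply: Ai; apply: sub_finite_set (_ : A `<=` (A `\` B) `|` B) _.
  by move=> x Ax; have [Bx|nBx] := pselect (B x); [right|left].
by rewrite finite_setU.
Qed.

Lemma infinite_nonempty (T : Type) (A : set T) : infinite_set A -> exists x, A x.
Proof. by move=> /infinite_setN0 [x Ax]; exists x. Qed.

Lemma infinite_image (T U : Type) (f : T -> U) (A : set T) :
  {in A &, injective f} -> infinite_set A -> infinite_set (f @` A).
Proof. by move=> inj Ai; rewrite (eq_finite_set (inj_card_eq inj)). Qed.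

Lemma image_setU1 (T U : Type) (f : T -> U) x (A : set T) : f @` (x |` A) = f x |` f @` A.
Proof. by rewrite image_setU image_set1. Qed.

Lemma finite_nat_bound (A : set nat) : finite_set A -> exists n, forall k, A k -> k < n.
Proof.
move: A; apply: finite_set_rect => [|n A _ _ [m Am]]; first by exists 0.
exists (maxn n.+1 m) => k [->|/Am km]; first by rewrite leq_max leqnn.
by rewrite leq_max km orbT.
Qed.

Section PointwiseTopology.
Variable I : Type.
Implicit Types (x y : {ptws I -> bool}) (U : set {ptws I -> bool}) (a : set I).

(** The cylinders over finite sets of coordinates form a filter that converges to [x] in each
    coordinate, hence in the product topology, so it contains every neighbourhood. Conversely, a
    cylinder is a finite intersection of preimages of points. *)
Lemma nbhs_ptwsP x U : nbhs x U <->
  exists2 a, finite_set a & forall y, (forall i, a i -> y i = x i) -> U y.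
Proof.
split=> [xU|[a fa aU]].
  pose B (a : set I) := [set y : {ptws I -> bool} | forall i, a i -> y i = x i].
  have FB : Filter (filter_from finite_set B).
    apply: filter_from_filter; first by exists set0; apply: finite_set0.
    move=> a b fa fb; exists (a `|` b); first by rewrite finite_setU.
    by move=> y yab; split=> i ?; apply: yab; [left|right].
  suff : filter_from finite_set B --> x by move=> /(_ _ xU) [a fa aU]; exists a.
  apply/cvg_sup => i; rewrite cvg_image; last first.
    by apply/seteqP; split=> // b _; exists (fun _ => b).
  move=> V /= xV.
  have Vx : V (x i) by apply: nbhs_singleton xV.
  exists ((fun g : I -> bool => g i) @^-1` V).
    by exists [set i]; [exact: finite_set1|move=> y /(_ i erefl) /= ->].
  by apply/seteqP; split=> [b [y Vy <-]//|b Vb]; exists (fun _ => b).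
have FF : Filter (nbhs x) by exact: nbhs_filter.
apply: filterS aU _.
move: a fa; apply: finite_set_rect => [|i a fa _ IH].
  by apply: filterS filterT => y _.
have /cvg_sup/(_ i)/cvg_image H : x --> x by exact: cvg_id.
have sf : [set (@^~ i) f | f in [set: I -> bool]] = setT.
  by apply/seteqP; split=> // b _; exists (fun _ => b).
have [W xW We] := H sf [set x i] (@discrete_set1 bool (x i)).
apply: filterS (filterI xW IH) => y [Wy ya] j [->|]; last exact: ya.
by have : [set x i] (y i) by rewrite -We; exists y.
Qed.

End PointwiseTopology.

(** * Ranks of hereditary families *)

Definition no_infinite (I : Type) (F : Family I) : Prop :=
  forall X : set I, infinite_set X -> ~ (forall s, finite_set s -> s `<=` X -> F s).

(** An infinite set whose finite subsets all lie in [F] is a limit of [F] that is not finite.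
    Conversely, heredity puts every finite subset of a limit in [F], so a limit is finite and itself
    a member. *)
Lemma compact_familyP (I : Type) (F : Family I) : hereditary F ->
  compact_family F <-> finitary F /\ no_infinite F.
Proof.
move=> hF; split=> -[fF cF]; split=> //.
  move=> X Xi XF; apply: Xi; apply: fF.
  suff : char_family F (fun i => `[<X i>] : bool).
    by rewrite /char_family/=; congr F; apply/seteqP; split=> i /=; move/asboolP.
  apply: cF => U /nbhs_ptwsP [a fa aU].
  exists (fun i => `[<(a `&` X) i>] : bool); split.
    rewrite /char_family/=; apply: XF; last by move=> i /= /asboolP [].
    by apply: sub_finite_set fa => i /= /asboolP [].
  by apply: aU => i ai; apply/asbool_equiv_eq; split=> [[]|xi].
move=> x clx; have xF s : finite_set s -> s `<=` [set i | x i] -> F s.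
  move=> fs sx; have /clx [y [yF ya]] : nbhs x [set y : {ptws I -> bool} | forall i, s i -> y i = x i].
    by apply/nbhs_ptwsP; exists s.
  by apply: hF yF _ => i si /=; rewrite ya //; apply: sx.
apply: (xF) => //; apply: contrapT => inf; exact: (cF _ inf xF).
Qed.

Lemma no_infinite_sub (I : Type) (F G : Family I) : F `<=` G -> no_infinite G -> no_infinite F.
Proof. by move=> FG nG X Xi XF; apply: nG Xi _ => s fs sX; apply: FG; apply: XF. Qed.

Lemma compact_sub (I : Type) (F G : Family I) : hereditary F -> hereditary G -> F `<=` G ->
  compact_family G -> compact_family F.
Proof.
move=> hF hG FG /(compact_familyP hG) [fG nG]; apply/(compact_familyP hF); split.
  by move=> s /FG /fG.
exact: no_infinite_sub nG.
Qed.

(* For hereditary [F], the derivatives of [F] are computed on singleton extensions: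
   [dv F a s] says that [s] belongs to the [a]-th derivative (see [CB_dv]). *)
Fixpoint dv (I : Type) (F : Family I) (a : Ord) (s : set I) : Prop :=
  match a with
  | Mk A f => F s /\ forall i, infinite_set [set j | ~ s j /\ dv F (f i) (j |` s)]
  end.

Section Derivative.
Variables (I : Type) (F : Family I).

Lemma dvW a s : dv F a s -> F s.
Proof. by case: a => A f []. Qed.

Lemma dv_anti a b s : a <=o b -> dv F b s -> dv F a s.
Proof.
elim: a b s => A f IH [B g] s /= ab [Fs H]; split=> // i.
have [j fg] := ab i; apply: sub_infinite_set (H j) => k [sk gk].
by split=> //; apply: IH gk.
Qed.

Lemma dv_succ a s : F s -> infinite_set [set j | ~ s j /\ dv F a (j |` s)] ->
  dv F (osucc a) s.
Proof. by split. Qed.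

Lemma not_dv_succ a s : F s -> ~ dv F (osucc a) s ->
  finite_set [set j | ~ s j /\ dv F a (j |` s)].
Proof. by move=> Fs; apply: contra_notP => inf; apply: dv_succ. Qed.

Lemma not_dv a s : F s -> ~ dv F a s -> exists2 b, b <o a & ~ dv F (osucc b) s.
Proof.
case: a => A f Fs; apply: contra_notP => H; split=> // i fin.
apply: H; exists (f i); first exact: olt_Mk.
by move=> [_ /(_ tt)].
Qed.

Lemma dv0 s : dv F ozero s <-> F s.
Proof. by split=> [[]|] //; split=> // -[]. Qed.

Hypothesis hF : hereditary F.

Lemma dv_hereditary a s t : t `<=` s -> dv F a s -> dv F a t.
Proof.
elim: a s t => A f IH s t ts [Fs H]; split; first exact: hF ts.
move=> i; apply: sub_infinite_set (H i) => j [sj dj]; split; first by move/ts.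
by apply: IH dj; apply: setUS.
Qed.

Hypothesis fF : finitary F.

(** Near [x] the members contain the finite set [s] of [x], and heredity cuts any such proper
    superset down to a one-point extension of [s]. Accumulation therefore amounts to having
    infinitely many such extensions. *)
Lemma CB_dv a (x : {ptws I -> bool}) : CB (char_family F) a x <-> dv F a [set i | x i].
Proof.
elim: a x => A f IH x.
split=> -[Fx H]; split=> //.
  move=> k; have [Cx Lx] := H k Logic.I.
  pose s := [set i | x i]; have fs : finite_set s by apply: fF.
  move=> fJ; set J := [set j | _] in fJ.
  (* Fixing the coordinates in [s] makes [y] a superset of [s]; fixing those in [J] forbids the new
     point of [y] to lie in [J], to which it belongs. *)
  have [|y [/eqP yx Cy ya]] := Lx [set y : {ptws I -> bool} | forall i, (s `|` J) i -> y i = x i].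
    by apply/nbhs_ptwsP; exists (s `|` J) => //; rewrite finite_setU.
  have sy : s `<=` [set i | y i] by move=> i si /=; rewrite ya //; left.
  have [j [yj nsj]] : exists j, y j /\ ~ s j.
    apply: contrapT => N; apply: yx; apply/funext => i.
    apply/idP/idP => [yi|xi]; last exact: sy.
    by apply: contrapT => /negP nxi; apply: N; exists i; split=> //; apply/negP.
  have Jj : J j.
    split=> //; apply: dv_hereditary (_ : j |` s `<=` [set i | y i]) _; last exact/IH.
    by move=> i [->|/sy].
  by apply: nsj; rewrite /s /= -(ya j) //; right.
move=> k _; have := H k; set J := [set j | _] => Ji.
split.
  apply/IH; have [j [nj dj]] := infinite_nonempty Ji.
  by apply: dv_hereditary dj => i xi; right.
move=> U /nbhs_ptwsP [a fa aU].
(* With [j] outside the finite set [a], adding [j] stays within the given cylinder. *)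
have [j [[nj dj] naj]] := infinite_nonempty (infinite_setDfin Ji fa).
pose y : {ptws I -> bool} := fun i => `[<(j |` [set i | x i]) i>].
exists y; split.
- apply/eqP => e; apply: nj; rewrite /= -e; apply/asboolP; by left.
- by apply/IH; rewrite (_ : [set i | y i] = j |` [set i | x i]) //; apply/seteqP; split=> i /=; move/asboolP.
- apply: aU => i ai; apply/idP/idP => [/asboolP [ij|//]|xi]; last by apply/asboolP; right.
  by move: naj; rewrite -ij.
Qed.

Lemma CB_nonempty a : CB (char_family F) a !=set0 <-> dv F a set0.
Proof.
split=> [[x /CB_dv]|d]; first exact: dv_hereditary.
exists (fun _ => false); apply/CB_dv.
by rewrite (_ : [set _ | _] = set0) //; apply/seteqP; split.
Qed.

End Derivative.

Lemma dv_sub (I : Type) (F G : Family I) a s : F `<=` G -> dv F a s -> dv G a s.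
Proof.
move=> FG; elim: a s => A f IH s [Fs H]; split; first exact: FG.
by move=> i; apply: sub_infinite_set (H i) => j [sj /IH].
Qed.

(* [hle F a s] says that [a] bounds the rank of [s] in the well-founded tree of the
   extensions of [s] in [F]. In contrast with [dv], all extensions count, not only
   those available in infinite number, so that this rank can exceed [rk]. *)
Fixpoint hle (I : Type) (F : Family I) (a : Ord) (s : set I) : Prop :=
  match a with
  | Mk A f => forall j, ~ s j -> F (j |` s) -> exists i, hle F (f i) (j |` s)
  end.

Section ExtensionRank.
Variables (I : Type) (F : Family I).

Lemma hle_homo a b s : a <=o b -> hle F a s -> hle F b s.
Proof.
elim: a b s => A f IH [B g] s ab /= H j sj Fj; have [i hi] := H j sj Fj.
by have [k fg] := ab i; exists k; apply: IH hi.
Qed.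

Lemma hleP a s : hle F a s <->
  forall j, ~ s j -> F (j |` s) -> exists2 b, b <o a & hle F b (j |` s).
Proof.
case: a => A f; split=> H j sj Fj; have [i] := H j sj Fj.
  by move=> hi; exists (f i) => //; apply: olt_Mk.
by move=> [k ik] hi; exists k; apply: hle_homo hi.
Qed.

Lemma dv_hle a b s : dv F a s -> hle F b s -> a <=o b.
Proof.
elim: a b s => A f IH b s [Fs H] hb; apply/ole_Mk => i.
have [j [sj dj]] := infinite_nonempty (H i).
have [c cb hc] := (hleP _ _).1 hb j sj (dvW dj).
exact: ole_lt_trans (IH _ _ _ dj hc) cb.
Qed.

Lemma hle_superset a s t : hereditary F -> finite_set t -> hle F a s -> F (t `|` s) -> hle F a (t `|` s).
Proof.
move=> hF; move: t; apply: finite_set_rect => [|j t ft tj IH]; first by rewrite set0U.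
move=> hs; rewrite -setUA => Fj.
have [sj|nsj] := pselect ((t `|` s) j); first by by rewrite setU1_id // in Fj *; exact: IH.
have ht : hle F a (t `|` s) by apply: IH => //; apply: hF Fj _ => i ti; right.
by have [b /oltW ba] := (hleP _ _).1 ht j nsj Fj; apply: hle_homo.
Qed.

(** A set without extension rank has a one-point extension without rank, since otherwise the strict
    supremum of the ranks of its extensions would do. Iterating collects an infinite set of new
    points all of whose finite subsets are in [F]. *)
Lemma no_infinite_hle s : no_infinite F -> hereditary F -> finite_set s -> F s -> exists a, hle F a s.
Proof.
move=> nF hF fs Fs; apply: contrapT => bad0.
pose bad (s : set I) := [/\ finite_set s, F s & ~ exists a, hle F a s].
have step (u : {s | bad s}) : {v : {s | bad s} & {j | ~ sval u j /\ sval v = j |` sval u}}.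
  case: u => u [fu Fu nu] /=.
  have /cid [j [uj Fj nj]] : exists j, [/\ ~ u j, F (j |` u) & ~ exists a, hle F a (j |` u)].
    apply: contrapT => N; apply: nu.
    have /choice [f fP] : forall j, exists a, ~ u j -> F (j |` u) -> hle F a (j |` u).
      move=> j; have [[a ha]|na] := pselect (exists a, hle F a (j |` u)); first by exists a.
      by exists ozero => uj Fj; case: N; exists j.
    by exists (Mk f) => j uj Fj; exists j; apply: fP.
  have bj : bad (j |` u) by split=> //; apply: finite_setU1.
  by exists (exist _ _ bj); exists j.
have bs : bad s by split.
pose next u := projT1 (step u); pose new u := sval (projT2 (step u)).
have newP u : ~ sval u (new u) /\ sval (next u) = new u |` sval u.
  exact: (svalP (projT2 (step u))).
pose u n := iter n next (exist _ s bs).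
have mono m n : m <= n -> sval (u m) `<=` sval (u n).
  elim: n => [|n IH]; first by rewrite leqn0 => /eqP ->.
  rewrite leq_eqVlt => /orP [/eqP ->//|/IH H] i /H ui.
  by rewrite /u iterS (newP _).2; right.
have unew n : sval (u n.+1) (new (u n)) by rewrite /u iterS (newP _).2; left.
apply: (nF (range (fun n => new (u n)))).
  apply: infinite_image infinite_nat => m n _ _ e.
  have lt k l : k < l -> new (u k) = new (u l) -> False.
    by move=> kl ekl; apply: (newP (u l)).1; rewrite -ekl; apply: mono kl _ (unew k).
  by have [/lt/(_ e)|/lt/(_ (esym e))|] := ltngtP m n.
move=> t ft tr.
have [n tn] : exists n, t `<=` sval (u n).
  move: t ft tr; apply: finite_set_rect => [_|j t ft tj IH jt]; first by exists 0.
  have [n tn] := IH (fun i ti => jt i (or_intror ti)).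
  have [m _ mj] := jt j (or_introl erefl).
  exists (maxn m.+1 n) => i [->|/tn]; last by apply: mono; rewrite leq_maxr.
  by rewrite -mj; apply: mono (unew m); rewrite leq_maxl.
by case: (svalP (u n)) => _ Fu _; apply: hF Fu tn.
Qed.

End ExtensionRank.

(** * Rank and small rank of nonempty hereditary compact families *)

Definition hcompact (I : Type) (F : Family I) : Prop :=
  [/\ hereditary F, compact_family F & F set0].

Lemma hcompactP (I : Type) (F : Family I) : hereditary F -> finitary F ->
  no_infinite F -> F set0 -> hcompact F.
Proof. by move=> hF fF nF F0; split=> //; apply/compact_familyP. Qed.

Lemma hcompact_no_infinite (I : Type) (F : Family I) : hcompact F -> no_infinite F.
Proof. by case=> hF /(compact_familyP hF) []. Qed.

Lemma hcompact_frestrict (I : Type) (F : Family I) C : hcompact F -> hcompact (frestrict F C).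
Proof.
case=> hF cF F0; have hC : hereditary (frestrict F C).
  by move=> s t [Fs sC] ts; split; [exact: hF ts|exact: subset_trans sC].
split=> //; last by split.
by apply: compact_sub cF => // s [].
Qed.

Lemma frestrictT (I : Type) (F : Family I) : frestrict F setT = F.
Proof. by apply/seteqP; split=> [s []|s Fs]; [|split]. Qed.

Section Rank.
Variables (I : Type) (F : Family I) (hcF : hcompact F).

(** This shows that [rk] is not the default of [olargest]: the extension rank bounds the stages that
    contain the empty set, and there is a last one. *)
Lemma dv_rk a : dv F a set0 <-> a <=o rk F.
Proof.
have [hF cF F0] := hcF; have [fF _] := cF.
have [lrk mrk] : is_largest (fun a => dv F a set0) (rk F).
  have -> : rk F = olargest (fun a => dv F a set0).
    by rewrite /rk; congr olargest; apply/funext => b; apply/propext; apply: CB_nonempty.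
  have [b hb] := no_infinite_hle (hcompact_no_infinite hcF) hF (@finite_set0 I) F0.
  have ex : exists a, ~ dv F a set0.
    by exists (osucc b) => d; apply: olt_irr (olt_le_trans (olt_succ b) (dv_hle d hb)).
  have [nd least] := oleastP ex.
  (* The failure already occurs at a successor [osucc c] with [c] below the first failing stage, so
     [c] is the last stage that holds. *)
  have [c cl nc] := not_dv F0 nd.
  apply: (@olargestP _ c); split.
    by apply: contrapT => /least; apply/oltNge.
  move=> d dd; apply/olt_succ_le; apply/oltNge => cd; apply: nc; exact: dv_anti dd.
by split=> [/mrk|/dv_anti]; last exact.
Qed.

Lemma hle_rk b : hle F b set0 -> rk F <=o b.
Proof. by apply: dv_hle; apply/dv_rk; apply: ole_refl. Qed.

End Rank.

Lemma rk_homo (I : Type) (F G : Family I) : hcompact F -> hcompact G -> F `<=` G -> rk F <=o rk G.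
Proof.
move=> hF hG FG; apply/(dv_rk hG); apply: dv_sub FG _.
by apply/(dv_rk hF); apply: ole_refl.
Qed.

Section SmallRank.
Variables (I : Type) (infI : infinite_set [set: I]).
Implicit Types F G : Family I.

Lemma srkP F : is_least (fun a => exists2 C : set I, infinite_set C & rk (frestrict F C) = a) (srk F).
Proof. by apply: oleastP; exists (rk (frestrict F setT)); exists setT. Qed.

Lemma srk_le F C : infinite_set C -> srk F <=o rk (frestrict F C).
Proof. by move=> iC; apply: (srkP F).2; exists C. Qed.

Lemma srk_ge F b : (forall C, infinite_set C -> b <=o rk (frestrict F C)) -> b <=o srk F.
Proof. by move=> H; have [[C iC <-] _] := srkP F; apply: H. Qed.

Lemma srk_rk F : srk F <=o rk F.
Proof. by rewrite -{2}(frestrictT F); apply: srk_le. Qed.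

Lemma srk_homo F G : hcompact F -> hcompact G -> F `<=` G -> srk F <=o srk G.
Proof.
move=> hF hG FG; apply: srk_ge => C iC; apply: ole_trans (srk_le F iC) _.
apply: rk_homo; try exact: hcompact_frestrict.
by move=> s [/FG].
Qed.

End SmallRank.

(* Passing from a point to the extensions lying in the same derivative can be done only
   finitely often, which costs a factor [omega]. *)
Lemma not_dv_hle (I : Type) (F : Family I) a s : hereditary F -> F s -> ~ dv F (osucc a) s ->
  exists n, hle F (oadd (omul omega a) (ofin n)) s.
Proof.
elim/Pchoice: I => I in F s *; move=> hF.
elim/(well_founded_ind olt_wf): a s => a IH s Fs nd.
pose J u := [set j | ~ u j /\ dv F a (j |` u)].
(* An extension that leaves the [a]-th derivative has some smaller [b] in place of [a], and [omega]
   times [b] plus a finite ordinal is below [omega] times [a]. *)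
have out n u j : ~ u j -> F (j |` u) -> ~ J u j ->
    exists2 b, b <o oadd (omul omega a) (ofin n) & hle F b (j |` u).
  move=> uj Fj nJj; have [b ba nb] : exists2 b, b <o a & ~ dv F (osucc b) (j |` u).
    by apply: not_dv => // dj; apply: nJj.
  have [m hm] := IH _ ba _ Fj nb; exists (oadd (omul omega b) (ofin m)) => //.
  apply: olt_le_trans (oadd_lel _ _); apply: olt_le_trans (omul_lt_add omega ba).
  by apply: oadd_ltr; apply: ofin_lt_omega.
(* Each extension within the [a]-th derivative uses up a point of the finite set [B], whose size is
   the finite summand. *)
have key n : forall (B : {fset I}) u, (#|` B| <= n)%N -> F u -> ~ dv F (osucc a) u ->
    J u `<=` [set` B] -> hle F (oadd (omul omega a) (ofin n)) u.
  elim: n => [|n IHn] B u Bn Fu nu JB; apply/hleP => j uj Fj;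
    (have [Jj|nJj] := pselect (J u j); last exact: out);
    have jB : j \in B := JB _ Jj.
    by move: Bn; rewrite leqn0 cardfs_eq0 => /eqP B0; rewrite B0 in jB.
  exists (oadd (omul omega a) (ofin n)); first by apply: oadd_ltr; apply: olt_succ.
  apply: (IHn (B `\ j)%fset) => //.
  - by move: Bn; rewrite (cardfsD1 j) jB.
  - move=> dj; apply: nu; apply: dv_hereditary dj => // i ui; by right.
  - move=> k [nk dk]; have kj : k <> j by move=> e; apply: nk; left.
    rewrite /= !inE; apply/andP; split; first exact/eqP.
    apply: (JB k); split; first by move=> uk; apply: nk; right.
    by apply: dv_hereditary dk => // i [->|ui]; [left|right; right].
have [B BE] : exists B : {fset I}, J s = [set` B].
  by apply/finite_fsetP; apply: not_dv_succ.
by exists #|` B|; apply: (key _ B) => //; rewrite BE.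
Qed.

Lemma rk_hle (I : Type) (F : Family I) : hcompact F ->
  exists n, hle F (oadd (omul omega (rk F)) (ofin n)) set0.
Proof.
move=> hcF; have [hF cF F0] := hcF; apply: not_dv_hle => // /(dv_rk hcF).
by apply/oltNge; apply: olt_succ.
Qed.

(** Finiteness keeps the common bound strictly below [g], because a maximum is taken instead of a
    supremum. The induction carries [Q] for [s] and for [s] with the new point. *)
Lemma finite_subset_bound (I : Type) (u : set I) (g : Ord) (Q : set I -> Ord -> Prop) :
  finite_set u -> (forall s a b, a <=o b -> Q s a -> Q s b) ->
  (forall s, s `<=` u -> exists2 b, b <o g & Q s b) ->
  exists2 b, b <o g & forall s, s `<=` u -> Q s b.
Proof.
move=> fu; move: u fu Q; apply: finite_set_rect => [Q Qm H|x u fu xu IH Q Qm H].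
  have [b bg Qb] := H set0 (@subset_refl _ _).
  by exists b => // s; rewrite subset0 => ->.
have [||b bg Qb] := IH (fun s a => Q s a /\ Q (x |` s) a).
- by move=> s a b ab [Qs Qxs]; split; apply: Qm ab _.
- move=> s su; have [b1 b1g Q1] := H s (subset_trans su (@subsetUr _ _ _)).
  have [|b2 b2g Q2] := H (x |` s); first exact: setUS.
  have [b12|/oltW b21] := ole_total b1 b2.
    by exists b2 => //; split=> //; apply: Qm b12 _.
  by exists b1 => //; split=> //; apply: Qm b21 _.
exists b => // s sxu; have [sx|nsx] := pselect (s x).
  rewrite -(setU1D1 sx); apply: (Qb _ _).2.
  by move=> y [sy nyx]; case: (sxu y sy).
by apply: (Qb _ _).1 => y sy; have [yx|//] := sxu y sy; rewrite yx in sy.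
Qed.

Lemma hereditary_join (I : Type) (F G : Family I) : hereditary F -> hereditary G -> hereditary (fjoin F G).
Proof.
move=> hF hG _ t [a Fa [b Gb <-]] tab.
exists (a `&` t); first by apply: hF Fa _ => x [].
exists (b `&` t); first by apply: hG Gb _ => x [].
by rewrite -setIUl; apply/setIidPr.
Qed.

(** A member of the join may be written as a union in several ways, and a new point lowers the rank
    of at least one of the two parts. The natural sum drops strictly in either case. *)
Lemma hle_join (I : Type) (F G : Family I) a b : hereditary F -> hereditary G ->
  finitary F -> finitary G -> hle F a set0 -> hle G b set0 ->
  hle (fjoin F G) (nadd a b) set0.
Proof.
move=> hF hG fF fG ha hb.
(* The invariant concerns every decomposition of [u], since an extension of [u] may restrict to any
   of them. *)
have key g : forall u, (forall s t, F s -> G t -> s `|` t = u ->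
    exists a b, [/\ hle F a s, hle G b t & nadd a b <=o g]) -> hle (fjoin F G) g u.
  elim/(well_founded_ind olt_wf): g => g IH u H; apply/hleP => j uj Fj.
  have fu : finite_set (j |` u).
    by have [s Fs [t Gt <-]] := Fj; rewrite finite_setU; split; [apply: fF|apply: fG].
  pose Q s t c := F s -> G t -> s `|` t = j |` u ->
    exists a b, [/\ hle F a s, hle G b t & nadd a b <=o c].
  have Qm s t c d : c <=o d -> Q s t c -> Q s t d.
    move=> cd Qc Fs Gt e; have [a1 [b1 [h1 h2 h3]]] := Qc Fs Gt e.
    by exists a1, b1; split=> //; apply: ole_trans cd.
  have g0 : ozero <o g.
    have [s Fs [t Gt e]] := Fj.
    have [|||a1 [b1 [h1 h2 h3]]] := H (s `\ j) (t `\ j).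
    - by apply: hF Fs _ => x [].
    - by apply: hG Gt _ => x [].
    - rewrite -setDUl e; apply/seteqP; split=> [x [[xj|//] nxj]|x ux]; first by case: nxj.
      by split; [right|move=> /= xj; rewrite xj in ux].
    apply: olt_le_trans h3; have : (s `|` t) j by rewrite e; left.
    case=> [sj|tj].
      have [|| a2 a21 _] := (hleP _ _ _).1 h1 j; [by move=> [_ /(_ erefl)]|by rewrite setU1D1|].
      by apply: ole_lt_trans (ozero_le _) (nadd_ltl b1 a21).
    have [|| a2 a21 _] := (hleP _ _ _).1 h2 j; [by move=> [_ /(_ erefl)]|by rewrite setU1D1|].
    by apply: ole_lt_trans (ozero_le _) (nadd_ltr a1 a21).
  (* A finite set has finitely many decompositions, so one [c] below [g] serves them all. Each is
     reached by removing [j] from both parts and putting it back. *)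
  have [c cg Hc] : exists2 c, c <o g & forall s, s `<=` j |` u -> forall t, t `<=` j |` u -> Q s t c.
    apply: finite_subset_bound => // [s c d cd Qc t tu|s su]; first exact: Qm cd (Qc t tu).
    apply: finite_subset_bound => // [t c d cd|t tu]; first exact: Qm cd.
    have [[Fs Gt e]|N] := pselect [/\ F s, G t & s `|` t = j |` u]; last first.
      by exists ozero => // Fs Gt e; case: N.
    have [|||a1 [b1 [h1 h2 h3]]] := H (s `\ j) (t `\ j).
    - by apply: hF Fs _ => x [].
    - by apply: hG Gt _ => x [].
    - rewrite -setDUl e; apply/seteqP; split=> [x [[xj|//] nxj]|x ux]; first by case: nxj.
      by split; [right|move=> /= xj; rewrite xj in ux].
    have reduce (K : Family I) d v : K v -> hle K d (v `\ j) ->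
        exists2 d', d' <=o d & hle K d' v /\ (v j -> d' <o d).
      move=> Kv hd; have [vj|nvj] := pselect (v j); last first.
        exists d; first exact: ole_refl.
        by split=> //; rewrite -(_ : v `\ j = v) //; apply/seteqP; split=> [x []//|x vx]; split=> // xj; apply: nvj; rewrite -xj.
      have [||d' d'd hd'] := (hleP _ _ _).1 hd j; [by move=> [_ /(_ erefl)]|by rewrite setU1D1|].
      rewrite setU1D1 // in hd'.
      by exists d'; [exact: oltW|split].
    have [a2 a21 [ha2 sa2]] := reduce _ _ _ Fs h1.
    have [b2 b21 [hb2 sb2]] := reduce _ _ _ Gt h2.
    exists (nadd a2 b2); last by move=> _ _ _; exists a2, b2; split=> //; apply: ole_refl.
    apply: olt_le_trans h3; have : (s `|` t) j by rewrite e; left.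
    case=> [/sa2|/sb2] lt.
      by apply: olt_le_trans (nadd_ltl b2 lt) _; apply: nadd_homo => //; apply: ole_refl.
    by apply: olt_le_trans (nadd_ltr a2 lt) _; apply: nadd_homo => //; apply: ole_refl.
  exists c => //; apply: IH => // s t Fs Gt e.
  by apply: (Hc s _ t _) => //; rewrite -e; [apply: subsetUl|apply: subsetUr].
apply: key => s t Fs Gt; rewrite setU_eq0 => -[-> ->].
by exists a, b; split=> //; apply: ole_refl.
Qed.

(** * Homogeneous families *)

(** Extending inside [X] would give an infinite descent of ordinals. Compactness of a family is thus
    obtained from any bound on its extension rank. *)
Lemma hle_no_infinite (I : Type) (F : Family I) a : hle F a set0 -> no_infinite F.
Proof.
move=> h0 X iX XF; suff : forall s, finite_set s -> s `<=` X -> ~ hle F a s.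
  by move=> /(_ set0 (@finite_set0 _) (@sub0set _ _)).
elim/(well_founded_ind olt_wf): a {h0} => a IH s fs sX /hleP h.
have [j [Xj sj]] := infinite_nonempty (infinite_setDfin iX fs).
have fj : finite_set (j |` s) by apply: finite_setU1.
have jX : j |` s `<=` X by move=> i [->|/sX].
by have [b ba hb] := h j sj (XF _ fj jX); exact: (IH b ba _ fj jX).
Qed.

Lemma hcompact_hle (I : Type) (F : Family I) : hcompact F -> exists a, hle F a set0.
Proof.
move=> hcF; have [hF cF F0] := hcF.
exact: no_infinite_hle (hcompact_no_infinite hcF) hF (@finite_set0 _) F0.
Qed.

Lemma hcompact_join (I : Type) (F G : Family I) : hcompact F -> hcompact G -> hcompact (fjoin F G).
Proof.
move=> hcF hcG; have [hF [fF _] F0] := hcF; have [hG [fG _] G0] := hcG.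
have [a ha] := hcompact_hle hcF; have [b hb] := hcompact_hle hcG.
apply: hcompactP.
- exact: hereditary_join.
- by move=> _ [s Fs [t Gt <-]]; rewrite finite_setU; split; [apply: fF|apply: fG].
- apply: hle_no_infinite (hle_join hF hG fF fG ha hb).
- by exists set0 => //; exists set0 => //; rewrite setU0.
Qed.

Lemma fjoin_subl (I : Type) (F G : Family I) : G set0 -> F `<=` fjoin F G.
Proof. by move=> G0 s Fs; exists s => //; exists set0 => //; rewrite setU0. Qed.

Lemma fjoin_subr (I : Type) (F G : Family I) : F set0 -> G `<=` fjoin F G.
Proof. by move=> F0 s Gs; exists set0 => //; exists s => //; rewrite set0U. Qed.

Lemma fjoin_homo (I : Type) (F F' G G' : Family I) : F `<=` F' -> G `<=` G' ->
  fjoin F G `<=` fjoin F' G'.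
Proof. by move=> FF GG _ [s /FF Fs [t /GG Gt <-]]; exists s => //; exists t. Qed.

Lemma nadd_closed_above l a : exp_indecomposable l -> omega <o l -> a <o l ->
  exists x, [/\ x <o l, a <o x & nadd_closed x].
Proof.
move=> lE wl al; exists (oexp_pos omega (osucc a)); split.
- by apply: exp_indecomposable_exp => //; apply: exp_indecomposable_succ.
- by apply/osucc_le; apply: ole_omega_exp.
- exact: nadd_closed_exp nadd_closed_omega.
Qed.

Lemma exp_indecomposable_nadd l a b : exp_indecomposable l -> omega <o l ->
  a <o l -> b <o l -> nadd a b <o l.
Proof.
move=> lE wl al bl.
have [c [cl ac bc]] : exists c, [/\ c <o l, a <=o c & b <=o c].
  have [ab|/oltW ba] := ole_total a b.
    by exists b; split=> //; apply: ole_refl.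
  by exists a; split=> //; apply: ole_refl.
have [x [xl cx [_ xN]]] := nadd_closed_above lE wl cl.
by apply: olt_trans xl; apply: xN; [apply: ole_lt_trans ac cx|apply: ole_lt_trans bc cx].
Qed.

(** Passing from [rk] to the extension rank costs a factor [omega] and a finite summand, which [l]
    absorbs. *)
Lemma rk_hle_lt (I : Type) (F : Family I) l : hcompact F -> exp_indecomposable l ->
  omega <o l -> rk F <o l -> exists2 a, a <o l & hle F a set0.
Proof.
move=> hcF lE wl Fl; have [n h] := rk_hle hcF; exists (oadd (omul omega (rk F)) (ofin n)) => //.
apply: exp_indecomposable_add => //; first exact: exp_indecomposable_mul.
by apply: olt_trans wl; apply: ofin_lt_omega.
Qed.

Lemma rk_join_lt (I : Type) (F G : Family I) l : hcompact F -> hcompact G ->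
  exp_indecomposable l -> omega <o l -> rk F <o l -> rk G <o l -> rk (fjoin F G) <o l.
Proof.
move=> hcF hcG lE wl Fl Gl.
have [a al ha] := rk_hle_lt hcF lE wl Fl; have [b bl hb] := rk_hle_lt hcG lE wl Gl.
apply: ole_lt_trans (exp_indecomposable_nadd lE wl al bl).
apply: hle_rk; first exact: hcompact_join.
by have [hF [fF _] _] := hcF; have [hG [fG _] _] := hcG; apply: hle_join.
Qed.

(** * Families of sets of bounded size *)

Lemma card_set_fset (T : choiceType) (B : {fset T}) : [set` B] #= `I_(#|` B|).
Proof. by have /finite_setP [n Bn] := finite_fset B; have := card_fset_set Bn; rewrite set_fsetK => ->. Qed.

Lemma card_le_uniq (T : choiceType) (l : seq T) n : uniq l -> [set` l] #<= `I_n -> size l <= n.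
Proof.
move=> ul; have -> : [set` l] = [set` [fset x in l]%fset].
  by apply/seteqP; split=> x /=; rewrite inE.
by rewrite (card_le_eql (card_set_fset _)) card_le_II card_fseq undup_id.
Qed.

Lemma subsets_leP (T : choiceType) n (s : set T) :
  subsets_le T n s <-> exists2 l : seq T, size l <= n & s `<=` [set` l].
Proof.
split=> [sn|[l ln sl]].
  have /finite_fsetP [B sB] : finite_set s by apply/finite_set_leP; exists n.
  exists B; last by rewrite sB.
  by apply: card_le_uniq => //; rewrite -sB.
apply: card_le_trans (subset_card_le sl) _.
have -> : [set` l] = [set` [fset x in l]%fset].
  by apply/seteqP; split=> x /=; rewrite inE.
rewrite (card_le_eql (card_set_fset _)) card_le_II card_fseq.
exact: leq_trans (size_undup _) ln.
Qed.

Lemma subsets_le_hle (I : Type) n : hle (@subsets_le I n) (ofin n) set0.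
Proof.
elim/Pchoice: I => I.
have cons j (l : seq I) : j |` [set` l] = [set` j :: l].
  apply/seteqP; split=> x /=; rewrite inE; first by case=> [->|->]; rewrite ?eqxx ?orbT.
  by case/orP=> [/eqP|]; [left|right].
suff key k (l : seq I) : uniq l -> size l + k = n -> hle (@subsets_le I n) (ofin k) [set` l].
  by have := key n [::] isT erefl; congr hle; apply/seteqP; split.
elim: k l => [|k IH] l ul ln; apply/hleP => j /negP jl; rewrite cons => lj.
  have /card_le_uniq /= : [set` j :: l] #<= `I_n by [].
  by rewrite jl ul -ln addn0 ltnn => /(_ isT).
exists (ofin k); first exact: olt_succ.
by apply: IH => /=; [rewrite jl|rewrite addSnnS].
Qed.

Lemma subsets_le_homo (I : Type) m n : m <= n -> @subsets_le I m `<=` @subsets_le I n.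
Proof. by move=> mn s sm; apply: card_le_trans sm _; rewrite card_le_II. Qed.

Lemma subsets_le_set0 (I : Type) n : @subsets_le I n set0.
Proof. exact: card_ge0. Qed.

Lemma hcompact_subsets_le (I : Type) n : hcompact (@subsets_le I n).
Proof.
apply: hcompactP.
- by move=> s t sn ts; apply: card_le_trans (subset_card_le ts) sn.
- by move=> s sn; apply/finite_set_leP; exists n.
- exact: hle_no_infinite (subsets_le_hle I n).
- exact: subsets_le_set0.
Qed.

Lemma subsets_le0 (I : Type) : @subsets_le I 0 = [set set0].
Proof.
apply/seteqP; split=> [s|_ ->]; last exact: subsets_le_set0.
by rewrite /subsets_le/= II0 card_le0 => /eqP.
Qed.

Lemma subsets_le_join (I : Type) m n : fjoin (@subsets_le I m) (@subsets_le I n) `<=` @subsets_le I (m + n).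
Proof.
elim/Pchoice: I => I _ [s /subsets_leP [l lm sl] [t /subsets_leP [k kn tk] <-]].
apply/subsets_leP; exists (l ++ k); first by rewrite size_cat leq_add.
by move=> x [/sl|/tk] /=; rewrite mem_cat => ->; rewrite ?orbT.
Qed.

Lemma subsets_le1P (I : Type) (s : set I) : @subsets_le I 1 s <-> s = set0 \/ exists x, s = [set x].
Proof.
elim/Pchoice: I => I in s *; split=> [/subsets_leP [[|x [|y l]] // _ sl]|].
- by left; apply/seteqP; split=> y // /sl.
- have sx : s `<=` [set x] by move=> y /sl /=; rewrite inE => /eqP.
  by have /subset_set1 [->|->] := sx; [left|right; exists x].
- case=> [->|[x ->]]; first exact: subsets_le_set0.
  by apply/subsets_leP; exists [:: x] => // y /= ->; rewrite inE.
Qed.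

(** An ordinal that has something below it cannot be the default value [ozero] of [oleast]. *)
Lemma iota_ord_lt a b : b <o iota_ord a -> exists2 l, exp_indecomposable l & a <o l.
Proof.
move=> bi; apply: contrapT => N; suff e : iota_ord a = ozero by move: bi; rewrite e => -[[]].
rewrite /iota_ord /oleast /choose_ord; case: pselect => // h; case: N.
by have [l [[lE al] _]] := h; exists l.
Qed.

Lemma iota_ord_ltP a b : b <o iota_ord a -> [/\ exp_indecomposable (iota_ord a), a <o iota_ord a &
  forall m, exp_indecomposable m -> a <o m -> iota_ord a <=o m].
Proof. by move=> /iota_ord_lt [l lE al]; apply: iota_ordP lE al. Qed.

Lemma iota_ord_fin a : a <o omega -> iota_ord a ~=o omega.
Proof.
move=> aw; have [iE ai H] := iota_ordP exp_indecomposable_omega aw.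
by split; [apply: H => //; apply: exp_indecomposable_omega|case: iE].
Qed.

Lemma iota_ord_oeq a b : a ~=o b -> iota_ord a = iota_ord b.
Proof.
move=> [ab ba]; apply: iota_ord_eq => m _.
by split; [apply: ole_lt_trans|apply: ole_lt_trans].
Qed.

Section Homogeneous.
Variables (I : Type) (infI : infinite_set [set: I]).
Implicit Types F G : Family I.

Lemma homogeneous_hcompact F : homogeneous F -> hcompact F.
Proof.
move=> [a [_ [cF hF H]]]; split=> //; case: H => [[_ ->]//|[_ H _ _ _]].
exact: (H _ (subsets_le_set0 _ _)).
Qed.

Lemma rk_subsets_le n : rk (@subsets_le I n) <=o ofin n.
Proof. by apply: hle_rk (subsets_le_hle I n); apply: hcompact_subsets_le. Qed.

Lemma homogeneous_iota F : homogeneous F ->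
  [/\ exp_indecomposable (iota_ord (srk F)), rk F <o iota_ord (srk F) &
      forall m, exp_indecomposable m -> srk F <o m -> iota_ord (srk F) <=o m].
Proof.
move=> homF; have hcF := homogeneous_hcompact homF.
case: homF => a [_ [_ _ [[_ F0]|[_ _ aF _ Fa]]]]; last first.
  rewrite (iota_ord_oeq aF) in Fa.
  by have [iE _ H] := iota_ord_ltP Fa.
have rF : rk F <=o ozero by rewrite F0 -subsets_le0; apply: rk_subsets_le.
have sF : srk F <o omega.
  apply: ole_lt_trans (srk_rk infI F) _.
  exact: ole_lt_trans rF (ofin_lt_omega 0).
have [iE _ H] := iota_ordP exp_indecomposable_omega sF.
by split=> //; apply: ole_lt_trans rF (exp_indecomposable_gt0 iE).
Qed.

Lemma srk_ge1 F : hcompact F -> @subsets_le I 1 `<=` F -> oone <=o srk F.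
Proof.
move=> hcF F1; apply: srk_ge => // C iC; apply/dv_rk; first exact: hcompact_frestrict.
apply: dv_succ; first by split=> //; apply: F1; apply: subsets_le_set0.
apply: sub_infinite_set iC => j Cj; split=> //; apply/dv0.
by rewrite setU0; split=> [|i ->//]; apply: F1; apply/subsets_le1P; right; exists j.
Qed.

Lemma homogeneous_cases F : homogeneous F ->
  F = [set set0] \/ (@subsets_le I 1 `<=` F /\ oone <=o srk F).
Proof.
move=> homF; have hcF := homogeneous_hcompact homF.
case: homF => a [_ [_ _ [[_ F0]|[_ F1 _ _ _]]]]; first by left.
by right; split=> //; apply: srk_ge1.
Qed.

(** The chain [a <=o srk F <=o rk F <o iota_ord a] leaves no exp-indecomposable ordinal between [a]
    and [srk F], so both have the same [iota_ord]. *)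
Lemma homogeneous_crit F a : hcompact F -> @subsets_le I 1 `<=` F ->
  a <=o srk F -> rk F <o iota_ord a ->
  homogeneous F /\ iota_ord (srk F) ~=o iota_ord a.
Proof.
move=> hcF F1 aF Fa; have [iE ai H] := iota_ord_ltP Fa.
have Fi : srk F <o iota_ord a := ole_lt_trans (srk_rk infI F) Fa.
have [jE Fj H'] := iota_ordP iE Fi.
have e : iota_ord (srk F) ~=o iota_ord a.
  by split; [apply: H'|apply: H => //; apply: ole_lt_trans aF Fj].
split=> //; exists (srk F).
have cF : octbl (srk F) by case: iE => + _ _; apply: octbl_le; apply: oltW.
split=> //; have [hF cptF _] := hcF; split=> //; right; split=> //.
- by split=> //; apply: srk_ge1.
- by split; apply: ole_refl.
- exact: srk_rk.
- by apply: olt_le_trans Fa e.2.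
Qed.

Lemma homogeneous_fin F n : hcompact F -> F `<=` @subsets_le I n ->
  @subsets_le I 1 `<=` F -> homogeneous F.
Proof.
move=> hcF Fn F1; have F0 : rk F <o omega.
  apply: ole_lt_trans (ofin_lt_omega n); apply: ole_trans (rk_subsets_le n).
  by apply: rk_homo Fn => //; apply: hcompact_subsets_le.
have sF : srk F <o omega := ole_lt_trans (srk_rk infI F) F0.
have [] // := @homogeneous_crit F (srk F) hcF F1 (ole_refl _).
exact: olt_le_trans F0 (iota_ord_fin sF).2.
Qed.

Lemma homogeneous_subsets_le n : homogeneous (@subsets_le I n).
Proof.
case: n => [|n]; last first.
  by apply: (@homogeneous_fin _ n.+1) => //; [apply: hcompact_subsets_le|apply: subsets_le_homo].
exists ozero; split; first by exists (fun _ => ozero) => b [].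
have [h c _] := hcompact_subsets_le I 0; split=> //.
by left; split; [split; apply: ole_refl|apply: subsets_le0].
Qed.

Lemma srk_fin F n : hcompact F -> F `<=` @subsets_le I n -> srk F <=o ofin n.
Proof.
move=> hcF Fn; apply: ole_trans (srk_rk infI F) _; apply: ole_trans (rk_subsets_le n).
by apply: rk_homo Fn => //; apply: hcompact_subsets_le.
Qed.

End Homogeneous.

(** * The binary tree over a well-order *)

Definition strict_well_order (K : Type) (lt : K -> K -> Prop) : Prop :=
  [/\ well_founded lt, forall x y z, lt x y -> lt y z -> lt x z &
      forall x y, [\/ lt x y, x = y | lt y x]].

(** The well-ordering principle yields a relation with unique minima of nonempty sets. Minima of
    sets of one, two or three points give reflexivity, totality, antisymmetry and transitivity, and
    the strict order is the negated converse. *)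
Lemma strict_well_order_exists (K : Type) : exists lt : K -> K -> Prop, strict_well_order lt.
Proof.
elim/Peq: K => K; have [R wo] := @wochoice.well_ordering_principle K.
have minP (P : K -> Prop) : (exists x, P x) -> exists z, P z /\ forall x, P x -> R z x.
  move=> [x Px]; have [|z [[zP lb] _]] := wo [pred x | `[<P x>]].
    by exists x; apply/asboolP.
  exists z; split; first exact/asboolP.
  by move=> y Py; apply: lb; apply/asboolP.
have Rxx x : R x x by have [|z [-> H]] := minP (fun y => y = x); [exists x|apply: H].
have tot x y : R x y \/ R y x.
  have [|z [[]-> H]] := minP (fun z => z = x \/ z = y); first by exists x; left.
    by left; apply: H; right.
  by right; apply: H; left.
have anti x y : R x y -> R y x -> x = y.
  move=> xy yx; have [|z [_ u]] := wo [pred z | (z == x) || (z == y)].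
    by exists x; rewrite inE eqxx.
  rewrite -(u x) ?(u y) //; split; rewrite ?inE ?eqxx ?orbT //;
    by move=> w; rewrite inE => /orP [/eqP ->|/eqP ->].
have tri x y : [\/ ~~ R y x, x = y | ~~ R x y].
  case: (boolP (R y x)) => [yx|nyx]; last by apply: Or31.
  by case: (boolP (R x y)) => [xy|nxy]; [apply: Or32; apply: anti|apply: Or33].
exists (fun x y => ~~ R y x); split; last exact: tri.
- move=> x; apply: contrapT => nA.
  have [|z [nz lz]] := minP (fun x => ~ Acc (fun x y => ~~ R y x) x); first by exists x.
  by apply: nz; constructor=> y /negP yz; apply: contrapT => /lz.
- move=> x y z yx zy; apply/negP => zx.
  have [|m [mP H]] := minP (fun m => [\/ m = x, m = y | m = z]); first by exists x; apply: Or31.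
  have mx := H x (Or31 _ _ erefl); have my := H y (Or32 _ _ erefl); have mz := H z (Or33 _ _ erefl).
  case: mP => e; rewrite e in mx my mz; [|by rewrite mx in yx|by rewrite my in zy].
  by have e' := anti _ _ mz zx; rewrite -e' my in zy.
Qed.

Section Tree.
Variables (K : Type) (lt : K -> K -> Prop) (lt_wo : strict_well_order lt).
Implicit Types (x y z : K -> bool) (g d : K) (s t : set (K -> bool)) (F : Family K).

Let lt_wf : well_founded lt. Proof. by case: lt_wo. Qed.
Let lt_tr b a c : lt a b -> lt b c -> lt a c. Proof. by case: lt_wo => _ H _; apply: H. Qed.
Let lt_tri a b : [\/ lt a b, a = b | lt b a]. Proof. by case: lt_wo. Qed.

Lemma lt_irr g : ~ lt g g.
Proof. by elim/(well_founded_ind lt_wf): g => g IH gg; apply: (IH g gg gg). Qed.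

Lemma lt_min (P : K -> Prop) : (exists g, P g) -> exists g, P g /\ forall d, lt d g -> ~ P d.
Proof.
move=> [g]; elim/(well_founded_ind lt_wf): g => g IH Pg.
have [[d dg Pd]|N] := pselect (exists2 d, lt d g & P d); first exact: IH Pd.
by exists g; split=> // d dg Pd; apply: N; exists d.
Qed.

(* [dsep x y g]: the branches [x] and [y] split at level [g]. *)
Definition dsep x y g := x g <> y g /\ forall d, lt d g -> x d = y d.

Definition agree x y g := forall d, lt d g \/ d = g -> x d = y d.

Lemma dsep_exists x y : x <> y -> exists g, dsep x y g.
Proof.
move=> xy; have [|g [ng H]] := @lt_min (fun g => x g <> y g).
  by apply: contrapT => N; apply: xy; apply/funext => g; apply: contrapT => ng; apply: N; exists g.
by exists g; split=> // d /H /contrapT.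
Qed.

Lemma dsep_sym x y g : dsep x y g -> dsep y x g.
Proof. by move=> [ne H]; split=> [e|d /H]; [apply: ne|]. Qed.

Lemma dsep_irr x g : ~ dsep x x g. Proof. by case. Qed.

Lemma dsep_uniq x y g d : dsep x y g -> dsep x y d -> g = d.
Proof. by move=> [ng Hg] [nd Hd]; case: (lt_tri g d) => // [/Hd|/Hg]. Qed.

Lemma agree_sym x y g : agree x y g -> agree y x g.
Proof. by move=> H d /H. Qed.

Lemma agree_lt x y g d : lt d g -> agree x y g -> agree x y d.
Proof. by move=> dg H e [ed|->]; apply: H; left=> //; apply: lt_tr ed dg. Qed.

Lemma dsep_agree x y g d : dsep x y g -> lt d g -> agree x y d.
Proof. by move=> [_ H] dg e [ed|->]; apply: H => //; apply: lt_tr ed dg. Qed.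

Lemma agree_dsep x y g d : agree x y g -> dsep x y d -> lt g d.
Proof.
move=> H [nd _]; case: (lt_tri g d) => // [e|dg]; case: nd; apply: H; [by right|by left].
Qed.

(* The tree is binary. *)
Lemma dsep_dsep_agree x y z g : dsep x y g -> dsep x z g -> agree y z g.
Proof.
move=> [ny Hy] [nz Hz] d [dg|->]; first by rewrite -Hy // Hz.
by move: ny nz; case: (x g) (y g) (z g) => -[] [].
Qed.

Lemma dsep_agree_dsep x y z g : dsep x y g -> agree y z g -> dsep x z g.
Proof.
move=> [ny Hy] H; split; first by rewrite -(H g) //; right.
by move=> d dg; rewrite Hy // H //; left.
Qed.

(** The branch [z] may lie outside [s], as it does for limits of sequences of sets. *)
Definition Dset z s : set K := [set g | exists2 y, s y & dsep z y g].

Lemma Dset_sub z s t : s `<=` t -> Dset z s `<=` Dset z t.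
Proof. by move=> st g [y /st ty yg]; exists y. Qed.

Lemma Dset_image z s : Dset z s !=set0 -> exists f : (K -> bool) -> K, Dset z s `<=` f @` s.
Proof.
move=> [g0 _]; have /choice [f fP] : forall y, exists g, forall d, dsep z y d -> g = d.
  move=> y; have [[g yg]|N] := pselect (exists g, dsep z y g).
    by exists g => d yd; rewrite (dsep_uniq yg yd).
  by exists g0 => d yd; case: N; exists d.
by exists f => g [y sy /fP yg]; exists y.
Qed.

Lemma Dset_card z s : Dset z s #<= s.
Proof.
have [[g Dg]|N] := pselect (Dset z s !=set0).
  have [|f fP] := @Dset_image z s; first by exists g.
  exact: card_le_trans (subset_card_le fP) (card_image_le _ _).
rewrite (_ : Dset z s = set0); first exact: card_ge0.
by apply/seteqP; split=> // g Dg; case: N; exists g.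
Qed.

Lemma Dset_finite z s : finite_set s -> finite_set (Dset z s).
Proof. exact: card_le_finite (Dset_card z s). Qed.

Definition tree_family F : Family (K -> bool) :=
  [set s | finite_set s /\ forall z, s z -> F (Dset z s)].

(** At the first level where two branches of an infinite set differ, the set falls into two nonempty
    halves, one of them infinite. Keep an infinite half, take the next branch [x] from the other,
    and iterate. *)
Lemma comb_exists (C : set (K -> bool)) : infinite_set C ->
  exists (x : nat -> K -> bool) (d : nat -> K),
    [/\ forall n, C (x n), forall m n, m < n -> dsep (x m) (x n) (d m) &
        forall m n, m < n -> lt (d m) (d n)].
Proof.
move=> iC.
have step (D : set (K -> bool)) : infinite_set D -> exists x g (E : set (K -> bool)),
    [/\ D x, infinite_set E, E `<=` D & forall y, E y -> dsep x y g].
  move=> iD; have [|g [[y [z [Dy Dz yz]]] H]] :=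
      @lt_min (fun g => exists y z, [/\ D y, D z & y g <> z g]).
    have [y Dy] := infinite_nonempty iD.
    have [z [Dz zy]] := infinite_nonempty (infinite_setDfin iD (finite_set1 y)).
    have [|g [zg _]] := @dsep_exists y z; first by move=> e; apply: zy.
    by exists g, y, z.
  have sep u v : D u -> D v -> u g <> v g -> dsep u v g.
    by move=> Du Dv uv; split=> // d /H N; apply: contrapT => nd; apply: N; exists u, v.
  have [b iE] : exists b, infinite_set [set w | D w /\ w g = b].
    apply: contrapT => N; apply: iD.
    apply: sub_finite_set (_ : _ `<=` [set w | D w /\ w g = true] `|` [set w | D w /\ w g = false]) _.
      by move=> w Dw; case e : (w g); [left|right].
    by rewrite finite_setU; split; apply: contrapT => i; apply: N; [exists true|exists false].
  have [x [Dx xb]] : exists x, D x /\ x g <> b.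
    have [yb|nyb] := pselect (y g = b); last by exists y.
    by exists z; split=> // zb; apply: yz; rewrite yb zb.
  exists x, g, [set w | D w /\ w g = b]; split=> //; first by move=> w [].
  by move=> w [Dw wb]; apply: sep => //; rewrite wb.
pose st := {D : set (K -> bool) | infinite_set D}.
have /choice [f fP] : forall D : st, exists r : (K -> bool) * K * st,
    [/\ sval D r.1.1, sval r.2 `<=` sval D & forall y, sval r.2 y -> dsep r.1.1 y r.1.2].
  move=> [D iD] /=; have [x [g [E [Dx iE ED H]]]] := step D iD.
  by exists (x, g, exist _ E iE).
pose D n := iter n (fun D => (f D).2) (exist _ C iC).
pose x n := (f (D n)).1.1; pose d n := (f (D n)).1.2.
have Dmono m n : m <= n -> sval (D n) `<=` sval (D m).
  elim: n => [|n IH]; first by rewrite leqn0 => /eqP ->.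
  rewrite leq_eqVlt => /orP [/eqP ->//|/IH H] y Dy; apply: H.
  by case: (fP (D n)) => _ + _; apply.
have xD n : sval (D n) (x n) by case: (fP (D n)).
have xx m n : m < n -> dsep (x m) (x n) (d m).
  by move=> mn; case: (fP (D m)) => _ _; apply; apply: (Dmono m.+1 n mn).
exists x, d; split=> // [n|m n mn]; first exact: (Dmono 0 n).
(* Both branches split from [x m] at [d m], so in a binary tree they agree up to that level and
   split higher. *)
have a : agree (x n) (x n.+1) (d m).
  by apply: dsep_dsep_agree (xx m n mn) (xx m n.+1 _); apply: leqW.
exact: agree_dsep a (xx n n.+1 (ltnSn n)).
Qed.

(** * Comparing derivatives on a comb and on its levels *)

Section Comb.
Variables (x : nat -> K -> bool) (d : nat -> K).
Hypothesis xd : forall m n, m < n -> dsep (x m) (x n) (d m).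
Hypothesis dd : forall m n, m < n -> lt (d m) (d n).

Lemma comb_inj : injective x.
Proof.
by move=> m n e; case: (ltngtP m n) => // /xd; rewrite e => /dsep_irr.
Qed.

Lemma level_inj : injective d.
Proof.
by move=> m n e; case: (ltngtP m n) => // /dd; rewrite e => /lt_irr.
Qed.

Lemma Dset_comb m (t : set nat) : t m -> Dset (x m) (x @` t) `<=` d @` t.
Proof.
move=> tm g [_ [n tn <-] mn]; case: (ltngtP m n) => [mn'|nm|e].
- by exists m => //; apply: dsep_uniq (xd mn') mn.
- by exists n => //; apply: dsep_uniq (dsep_sym (xd nm)) mn.
- by move: mn; rewrite e => /dsep_irr.
Qed.

Lemma Dset_comb_top m (t : set nat) : (forall n, t n -> n < m) -> d @` t `<=` Dset (x m) (x @` t).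
Proof. by move=> tm _ [n tn <-]; exists (x n); [exists n|apply: dsep_sym; apply: xd; apply: tm]. Qed.

Lemma image_notin (T : Type) (f : nat -> T) (t : set nat) n : injective f -> ~ t n -> ~ (f @` t) (f n).
Proof. by move=> fi tn [m tm /fi e]; apply: tn; rewrite -e. Qed.

(** Any branch of the comb sees only levels indexed by [t], so members on the levels give members on
    the comb; injectivity of [x] preserves the infinitude of extensions. *)
Lemma dv_comb F (C : set (K -> bool)) a (t : set nat) : hereditary F -> (forall n, C (x n)) -> finite_set t ->
  dv (frestrict F (range d)) a (d @` t) ->
  dv (frestrict (tree_family F) C) a (x @` t).
Proof.
move=> hF Cx; elim: a t => A f IH t ft [[Ft _] H]; split.
  split; last by move=> _ [n _ <-].
  split=> [|_ [n tn <-]]; first exact: finite_image.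
  by apply: hF Ft _; apply: Dset_comb.
move=> i; have iJ : infinite_set [set n | ~ t n /\ dv (frestrict F (range d)) (f i) (d n |` d @` t)].
  move=> fJ; apply: (H i); apply: sub_finite_set (finite_image d fJ) => j [nj dj].
  have [n _ e] : range d j by have [_ /(_ j (or_introl erefl))] := dvW dj.
  exists n => //; rewrite /= e; split=> // tn; apply: nj; by exists n.
apply: sub_infinite_set (infinite_image _ iJ) => [_ [n [tn dn] <-]|]; last first.
  by move=> m n _ _; apply: comb_inj.
split; first exact: image_notin comb_inj tn.
rewrite -image_setU1; apply: IH; first exact: finite_setU1.
by rewrite image_setU1.
Qed.

(** A branch of [t] need not see all levels of [t], but a later branch of the comb does. The
    additional derivative on the left provides one. *)
Lemma comb_dv F b (t : set nat) : hereditary F -> finite_set t ->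
  dv (frestrict (tree_family F) (range x)) (oadd oone b) (x @` t) ->
  dv (frestrict F (range d)) b (d @` t).
Proof.
move=> hF; elim: b t => B h IH t ft dt; split.
  have /(_ tt) iJ := (dv_anti (omaxl _ _) dt).2.
  have [N tN] := finite_nat_bound ft.
  have [j [[nj dj] out]] := infinite_nonempty (infinite_setDfin iJ (finite_image x (finite_II N))).
  have [m _ e] : range x j by have [_ /(_ j (or_introl erefl))] := dj.1.
  have Nm : N <= m by rewrite leqNgt; apply/negP => mN; apply: out; exists m.
  split; last by move=> _ [n tn <-]; exists n.
  have [[_ /(_ (x m) (or_introl e)) FD] _] := dj.1; apply: hF FD _.
  apply: subset_trans (Dset_comb_top _) (Dset_sub (@subsetUr _ _ _)) => n /tN nN.
  exact: leq_trans nN Nm.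
move=> i; have iJ := (dv_anti (omaxr _ _) dt).2 i.
have iN : infinite_set [set n | ~ t n /\ dv (frestrict (tree_family F) (range x)) (oadd oone (h i)) (x n |` x @` t)].
  move=> fJ; apply: iJ; apply: sub_finite_set (finite_image x fJ) => j [nj dj].
  have [n _ e] : range x j by have [_ /(_ j (or_introl erefl))] := dvW dj.
  exists n => //; rewrite /= e; split=> // tn; apply: nj; by exists n.
apply: sub_infinite_set (infinite_image _ iN) => [_ [n [tn dn] <-]|]; last first.
  by move=> m n _ _; apply: level_inj.
split; first exact: image_notin level_inj tn.
rewrite -image_setU1; apply: IH; first exact: finite_setU1.
by rewrite image_setU1.
Qed.

End Comb.

End Tree.

(** * The rank of a tree family *)

Lemma hle_family (I : Type) (F G : Family I) a s : F `<=` G -> hle G a s -> hle F a s.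
Proof.
move=> FG; elim: a s => A f IH s H j sj Fj; have [i hi] := H j sj (FG _ Fj).
by exists i; apply: IH.
Qed.

Section TreeFamily.
Variables (K : Type) (lt : K -> K -> Prop) (lt_wo : strict_well_order lt).
Implicit Types (x y z : K -> bool) (g d : K) (s t : set (K -> bool)) (F : Family K).
Local Notation dsep := (dsep lt).
Local Notation Dset := (Dset lt).
Local Notation tree_family := (tree_family lt).

Lemma Dset_setU1 x y s g : dsep x y g -> Dset x (y |` s) = g |` Dset x s.
Proof.
move=> xy; apply/seteqP; split=> [h [z [->|sz] xz]|h [->|[z sz xz]]].
- by left; exact: (dsep_uniq lt_wo xz xy).
- by right; exists z.
- by exists y => //; left.
- by exists z => //; right.
Qed.

Lemma Dset_set1 x : Dset x [set x] = set0.
Proof. by apply/seteqP; split=> // g [y -> xx]; case: (dsep_irr xx). Qed.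

(* The part above a node of a tree in [tree_family F], where [c] is the set of the
   splitting levels below that node. *)
Definition above_family F (c : set K) : Family (K -> bool) :=
  [set s | [/\ finite_set s, forall z, s z -> F (c `|` Dset z s) &
    forall y z g, s y -> s z -> dsep y z g -> forall d, c d -> lt d g]].

Lemma above_family_hereditary F c : hereditary F -> hereditary (above_family F c).
Proof.
move=> hF s t [fs Fs cs] ts; split; first exact: sub_finite_set ts fs.
  by move=> z /ts /Fs Fz; apply: hF Fz _; apply: setUS; apply: Dset_sub.
by move=> y z g /ts sy /ts sz; apply: cs.
Qed.

Lemma tree_family_above F : tree_family F `<=` above_family F set0.
Proof. by move=> s [fs Fs]; split=> // z sz; rewrite set0U; apply: Fs. Qed.

(** * An ordinal bound for the extension rank of a tree family *)

Section Bound.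
Variables (F : Family K) (hF : hereditary F) (a0 Z : Ord).
Hypotheses (ZC : nadd_closed Z) (a0Z : osucc a0 <o Z).

(** A section of rank [b] will have a tree of rank at most [Theta b] times [a0 + 1]. As [Z] exceeds
    [a0 + 1], this is below [Theta a] for [b <o a], and natural sums of such ordinals remain below
    [Theta a]. *)
Let Theta a := oexp_pos Z (osucc a).

Lemma Theta_closed a : nadd_closed (Theta a).
Proof. exact: nadd_closed_exp. Qed.

Lemma Theta_gt1 a : oone <o Theta a.
Proof.
apply: ole_lt_trans (_ : osucc a0 <o Theta a); first by apply: osucc_homo; apply: ozero_le.
apply: olt_le_trans a0Z _.
apply: ole_trans (oexp_pos_step Z (olt_succ a)).
by apply: ole_trans (mul1o Z) _; apply: omul_homol; apply: oexp_pos_ge1.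
Qed.

Lemma Theta_step a b : b <o a -> omul (Theta b) (osucc a0) <o Theta a.
Proof.
move=> ba; apply: olt_le_trans (omul_ltr (oexp_pos_gt0 _ _) a0Z) _.
by apply: oexp_pos_step; apply/olt_succ_le; apply/osucc_le.
Qed.

(** The extension rank in [U] is the second coordinate of the lexicographic argument, which counts
    down while no new splitting level appears on [x]. *)
Definition controls c x (d : set K) (U : Family (K -> bool)) :=
  [/\ hereditary U, finitary U &
      forall s, above_family F c s -> s x -> Dset x s `<=` d -> U s].

(** The branches that split from [x] at a level [g] of [d] form a tree over the section of [F] at
    [g], of rank below [a]. Joining these finitely many tree families with the family for [x] alone
    gives [U]. *)
Lemma controlsP a c x (d : set K) :
  (forall b g, b <o a -> hle F b (g |` c) ->
     hle (above_family F (g |` c)) (omul (Theta b) (osucc a0)) set0) ->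
  hle F a c -> finite_set d -> (forall g, d g -> ~ c g) -> F (c `|` d) ->
  exists U, controls c x d U /\ exists2 e, e <o Theta a & hle U e set0.
Proof.
move=> IH hc; move: d; apply: finite_set_rect => [_ _|g d fd dg IHd dc Fd].
  (* With no splitting level allowed, the only branch is [x]. *)
  exists (@subsets_le (K -> bool) 1); split; last first.
    by exists (ofin 1); [exact: Theta_gt1|exact: subsets_le_hle].
  have [h [f _] _] := hcompact_subsets_le (K -> bool) 1; split=> // s _ sx D0.
  apply/subsets_le1P; right; exists x; apply/seteqP; split=> [y sy|_ ->//].
  apply: contrapT => yx; have [k xk] := dsep_exists lt_wo (fun e : x = y => yx (esym e)).
  by apply: (D0 k); exists y.
have [||U [[hU fU UP] [e eT he]]] := IHd.
- by move=> k dk; apply: dc; right.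
- by apply: hF Fd _; apply: setUS; apply: subsetUr.
have gc : ~ c g by apply: dc; left.
have [|b ba hb] := (hleP _ _ _).1 hc g gc.
  by apply: hF Fd _ => k [->|ck]; [right; left|left].
have hG := IH b g ba hb; set G := above_family F (g |` c) in hG.
have hGh : hereditary G by apply: above_family_hereditary.
have fG : finitary G by move=> s [].
exists (fjoin G U); split; last first.
  exists (nadd (omul (Theta b) (osucc a0)) e); last exact: hle_join.
  by apply: (Theta_closed a).2 => //; apply: Theta_step.
split; first exact: hereditary_join.
  by move=> _ [s Gs [t Ut <-]]; rewrite finite_setU; split; [apply: fG|apply: fU].
move=> s cs sx Dd; have [fs Fs lts] := cs.
exists [set y | s y /\ dsep x y g]; last first.
  exists [set y | s y /\ ~ dsep x y g]; last first.
    by apply/seteqP; split=> [y [[]|[]]//|y sy]; have [xy|] := pselect (dsep x y g); [left|right].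
  apply: UP; first by apply: above_family_hereditary cs _ => // y [].
    by split=> // xx; case: (dsep_irr xx).
  move=> k [y [sy nxy] xy]; have [kg|//] : (g |` d) k by apply: Dd; exists y.
  by case: nxy; rewrite -kg.
split; first by apply: sub_finite_set fs => y [].
(* The level [g] is itself a splitting level of [z], witnessed by [x] in [s]. *)
- move=> z [sz xz]; apply: hF (Fs z sz) _ => k [[->|ck]|[y [sy _] yz]].
  + by right; exists x => //; apply: dsep_sym.
  + by left.
  + by right; exists y.
- move=> y z k [sy xy] [sz xz] yz h [->|ch]; last exact: lts yz _ ch.
  exact: (agree_dsep lt_wo (dsep_dsep_agree xy xz) yz).
Qed.

(* The lexicographic bound: a new splitting level on the branch [x] decreases [r], any
   other new branch decreases [e]. *)
Lemma above_family_hle_step a c x r e s U :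
  (forall b g, b <o a -> hle F b (g |` c) ->
     hle (above_family F (g |` c)) (omul (Theta b) (osucc a0)) set0) ->
  hle F a c -> e <o Theta a -> above_family F c s -> s x -> hle F r (c `|` Dset x s) ->
  controls c x (Dset x s) U -> hle U e s ->
  hle (above_family F c) (oadd (omul (Theta a) r) e) s.
Proof.
move=> IH hc.
elim/(well_founded_ind olt_wf): r e s U => r IHr e.
elim/(well_founded_ind olt_wf): e => e IHe s U eT cs sx hr cU hU.
apply/hleP => y sy cs'; have [fs' Fs' lts'] := cs'.
have [g xy] : exists g, dsep x y g.
  by apply: (dsep_exists lt_wo) => xy; apply: sy; rewrite -xy.
have sx' : (y |` s) x by right.
have Ds' := Dset_setU1 s xy.
(* At an old level the same [U] still controls and [e] drops. At a new level [r] drops, and [e]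
   restarts below [Theta a] with a control for the enlarged set of levels. *)
have [Dg|Dg] := pselect (Dset x s g).
  rewrite (setU1_id Dg) in Ds'.
  have Us' : U (y |` s) by case: cU => _ _; apply => //; rewrite Ds'.
  have [e' ee' he'] := (hleP _ _ _).1 hU y sy Us'.
  exists (oadd (omul (Theta a) r) e'); first exact: oadd_ltr.
  by apply: IHe he' => //; [exact: olt_trans ee' eT|rewrite Ds'|rewrite Ds'].
have dc h : Dset x (y |` s) h -> ~ c h.
  by move=> [z sz xz] ch; apply: (lt_irr lt_wo (lts' _ _ _ sx' sz xz _ ch)).
have cg : ~ c g by apply: dc; rewrite Ds'; left.
have cE : c `|` Dset x (y |` s) = g |` (c `|` Dset x s) by rewrite Ds' setUCA.
have [||r' rr' hr'] := (hleP _ _ _).1 hr g; [by case| |].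
  by rewrite -cE; apply: Fs'.
have fD : finite_set (Dset x (y |` s)) by apply: Dset_finite.
have [U' [cU' [e' e'T he']]] := controlsP x IH hc fD dc (Fs' x sx').
exists (oadd (omul (Theta a) r') e').
  apply: olt_le_trans (oadd_lel _ _); apply: olt_le_trans (omul_lt_add _ rr').
  exact: oadd_ltr.
apply: (IHr r' rr' e' (y |` s) U') => //; first by rewrite cE.
rewrite -(setU0 (y |` s)); have [hU' _ UP'] := cU'.
by apply: hle_superset => //; rewrite setU0; apply: UP'.
Qed.

Lemma above_family_hle a c : a <=o a0 -> hle F a c ->
  hle (above_family F c) (omul (Theta a) (osucc a0)) set0.
Proof.
elim/(well_founded_ind olt_wf): a c => a IH c aa0 hc.
have {}IH b g : b <o a -> hle F b (g |` c) ->
     hle (above_family F (g |` c)) (omul (Theta b) (osucc a0)) set0.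
  by move=> ba; apply: IH => //; apply: ole_trans (oltW ba) aa0.
apply/hleP => x _; rewrite setU0 => cx; have [fx Fx _] := cx.
have [||U [cU [e eT he]]] := controlsP x IH hc (@finite_set0 K); first by [].
  by have := Fx x erefl; rewrite Dset_set1.
(* After the first branch [x] the lexicographic pair starts at [a] and some [e] below [Theta a],
   hence below [Theta a] times [a0 + 1]. *)
exists (oadd (omul (Theta a) a) e).
  apply: olt_le_trans (oadd_ltr _ eT) _; apply: omul_lt_add.
  exact/olt_succ_le.
apply: (above_family_hle_step (U := U) IH hc eT cx erefl); rewrite ?Dset_set1 ?setU0 //.
rewrite -(setU0 [set x]); have [hU _ UP] := cU.
by apply: hle_superset => //; rewrite setU0; apply: UP => //; rewrite Dset_set1.
Qed.

End Bound.

(** A comb inside a set violating compactness would make its infinite set of levels violate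
    compactness of [F]. *)
Lemma tree_family_hcompact F : hcompact F -> hcompact (tree_family F).
Proof.
move=> hcF; have [hF _ F0] := hcF; apply: hcompactP.
- move=> s t [fs Fs] ts; split; first exact: sub_finite_set ts fs.
  by move=> z /ts /Fs Fz; apply: hF Fz _; apply: Dset_sub.
- by move=> s [].
- move=> X iX XF; have [x [d [Xx xd dd]]] := comb_exists lt_wo iX.
  apply: (hcompact_no_infinite hcF (infinite_image (f := d) (A := setT) _ infinite_nat)).
    by move=> m n _ _; apply: (level_inj lt_wo dd).
  move=> u fu ud; pose t := d @^-1` u.
  have ft : finite_set t by apply: finite_preimage fu => m n _ _; apply: (level_inj lt_wo dd).
  have [m tm] := finite_nat_bound ft.
  (* The index [m] lies beyond [t], so the branch [x m] sees every level indexed by [t]. *)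
  have [_ Fm] : tree_family F (x @` (m |` t)).
    by apply: XF; [apply: finite_image; apply: finite_setU1|move=> _ [n _ <-]].
  have {}Fm := Fm (x m) (imageP x (or_introl erefl)).
  apply: hF Fm _ => g ug; have [n _ dn] := ud g ug.
  by exists (x n); [exists n => //; right; rewrite /t /= dn|rewrite -dn; apply: dsep_sym; apply: xd; apply: tm; rewrite /t /= dn].
- by split=> //; apply: finite_set0.
Qed.

Lemma tree_family_sub1 F : hcompact F -> @subsets_le (K -> bool) 1 `<=` tree_family F.
Proof.
move=> hcF s /subsets_le1P [->|[x ->]]; first by case: (tree_family_hcompact hcF).
split=> [|_ ->]; first exact: finite_set1.
by rewrite Dset_set1; case: hcF.
Qed.

Lemma rk_tree_family F l : hcompact F -> exp_indecomposable l -> omega <o l ->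
  rk F <o l -> rk (tree_family F) <o l.
Proof.
move=> hcF lE wl Fl; have [a al ha] := rk_hle_lt hcF lE wl Fl.
have al' := exp_indecomposable_succ lE al.
have [Z [Zl aZ ZC]] := nadd_closed_above lE wl al'.
have [hF _ _] := hcF.
apply: (@ole_lt_trans (omul (oexp_pos Z (osucc a)) (osucc a))); last first.
  by apply: exp_indecomposable_mul => //; apply: exp_indecomposable_exp.
apply: hle_rk; first exact: tree_family_hcompact.
apply: hle_family (@tree_family_above F) _.
exact: (above_family_hle hF ZC aZ (ole_refl a) ha).
Qed.

Hypothesis infK : infinite_set [set: K].

Lemma infinite_branches : infinite_set [set: K -> bool].
Proof.
pose f (k : K) : K -> bool := fun k' => `[<k' = k>].
have fi : {in [set: K] &, injective f}.
  move=> k k' _ _ e; have : f k k by apply/asboolP.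
  by rewrite e => /asboolP.
by apply: sub_infinite_set (infinite_image fi infK).
Qed.

Lemma srk_tree_family_ge F : hcompact F -> srk F <=o srk (tree_family F).
Proof.
move=> hcF; have [hF _ _] := hcF; have htF := tree_family_hcompact hcF.
apply: (srk_ge infinite_branches) => C iC.
have [x [d [Cx xd dd]]] := comb_exists lt_wo iC.
have iD : infinite_set (range d).
  by apply: infinite_image infinite_nat => m n _ _; apply: (level_inj lt_wo dd).
apply: ole_trans (srk_le infK F iD) _.
apply/(dv_rk (hcompact_frestrict C htF)).
have := dv_comb lt_wo xd (t := set0) (a := rk (frestrict F (range d))) hF Cx (@finite_set0 _).
rewrite !image_set0; apply.
by apply/(dv_rk (hcompact_frestrict _ hcF)); apply: ole_refl.
Qed.

(** The small rank of [F] is attained on some [C]; a comb among the indicator functions of the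
    points of [C] has its levels in [C]. *)
Lemma srk_tree_family_le F : hcompact F -> omega <=o srk F -> srk (tree_family F) <=o srk F.
Proof.
move=> hcF wF; have [hF _ _] := hcF; have htF := tree_family_hcompact hcF.
have [[C iC CF] _] := srkP infK F.
pose f (k : K) : K -> bool := fun k' => `[<k' = k>].
have fT k : f k k by apply/asboolP.
have fF k k' : k' <> k -> f k k' = false by move=> kk; apply/asboolP.
have fi : {in C &, injective f}.
  by move=> k k' _ _ e; have := fT k; rewrite e => /asboolP.
have [x [d [Cx xd dd]]] := comb_exists lt_wo (infinite_image fi iC).
have dC n : C (d n).
  (* Two singleton indicators can differ only at their two points, so [d n] is one of them. *)
  have [k Ck kn] := Cx n; have [k' Ck' kn'] := Cx n.+1.
  have [+ _] := xd n n.+1 (ltnSn n); rewrite -kn -kn'.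
  have [->//|nk] := pselect (d n = k); have [->//|nk'] := pselect (d n = k').
  by rewrite !fF.
have ix : infinite_set (range x).
  by apply: infinite_image infinite_nat => m n _ _; apply: (comb_inj xd).
apply: ole_trans (srk_le infinite_branches _ ix) _; apply/oleNgt => /osucc_le lt1.
have : dv (frestrict (tree_family F) (range x)) (oadd oone (osucc (srk F))) set0.
  apply/(dv_rk (hcompact_frestrict _ htF)); apply: ole_trans lt1.
  apply: ole_trans (oaddS _ _).1 _; apply: osucc_homo; exact: oadd1_le.
have := comb_dv lt_wo xd dd (b := osucc (srk F)) (t := set0) hF (@finite_set0 _).
rewrite !image_set0 => /[apply] /(dv_rk (hcompact_frestrict _ hcF)).
rewrite osucc_le => lt2; apply: olt_irr (olt_le_trans lt2 _).
rewrite -CF; apply: rk_homo; try exact: hcompact_frestrict.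
by move=> s [Fs sd]; split=> // k /sd [n _ <-].
Qed.

Lemma tree_family_homogeneous F : homogeneous F -> omega <=o srk F ->
  homogeneous (tree_family F) /\ iota_ord (srk (tree_family F)) ~=o iota_ord (srk F).
Proof.
move=> homF wF; have hcF := homogeneous_hcompact homF.
have [iE Fi _] := homogeneous_iota infK homF.
apply: (homogeneous_crit infinite_branches (tree_family_hcompact hcF)).
- exact: tree_family_sub1.
- exact: srk_tree_family_ge.
- apply: rk_tree_family => //.
  exact: ole_lt_trans wF (ole_lt_trans (srk_rk infK F) Fi).
Qed.

End TreeFamily.

(** * Multiplication *)

Definition increasing_nat (f : nat -> nat) : Prop := forall m n, m < n -> f m < f n.

Lemma increasing_nat_ge f n : increasing_nat f -> n <= f n.
Proof. by move=> fi; elim: n => // n IH; apply: leq_ltn_trans IH _; apply: fi. Qed.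

Lemma increasing_nat_inj f : increasing_nat f -> injective f.
Proof. by move=> fi m n e; case: (ltngtP m n) => // /fi; rewrite e ltnn. Qed.

Lemma increasing_nat_comp f g : increasing_nat f -> increasing_nat g -> increasing_nat (f \o g).
Proof. by move=> fi gi m n mn; apply: fi; apply: gi. Qed.

Lemma finite_nat_enum (x : set nat) : finite_set x -> x !=set0 ->
  exists (k : nat) (m : 'I_k.+1 -> nat), (forall i j : 'I_k.+1, i < j -> m i < m j) /\ range m = x.
Proof.
move=> /finite_seqP [l0 xl0] [n0 xn0].
pose l := sort leq (undup l0).
have ls : sorted ltn l.
  by rewrite ltn_sorted_uniq_leq sort_uniq undup_uniq /=; apply: sort_sorted; apply: leq_total.
have xl : x = [set` l] by rewrite xl0; apply/seteqP; split=> n /=; rewrite mem_sort mem_undup.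
case: l ls xl => [|a l] ls xl; first by rewrite xl in xn0.
exists (size l), (fun i => nth 0 (a :: l) i); split.
  by move=> i j ij; apply: (sorted_ltn_nth ltn_trans 0 ls) => //; rewrite inE /= ltn_ord.
rewrite xl; apply/seteqP; split=> [_ [i _ <-]|n /= nl]; first by apply: mem_nth; rewrite /= ltn_ord.
have il : index n (a :: l) < (size l).+1 by rewrite index_mem.
by exists (Ordinal il) => //; rewrite nth_index.
Qed.

(** An increasing map moves every element of [x] to the right or fixes it. This permits passing to
    further subsequences. *)
Lemma spreading_image (H : Family nat) f x : spreading H -> increasing_nat f ->
  finite_set x -> H x -> H (f @` x).
Proof.
move=> sH fi fx Hx; have [x0|x0] := pselect (x !=set0); last first.
  have xE : x = set0 by apply/seteqP; split=> // n xn; apply: x0; exists n.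
  by rewrite xE image_set0 -xE.
have [k [m [mi mx]]] := finite_nat_enum fx x0.
have -> : f @` x = range (f \o m) by rewrite -mx image_comp.
apply: (sH k m (f \o m)) => //; last by rewrite mx.
  by move=> i j ij; apply: fi; apply: mi.
by move=> i; apply: increasing_nat_ge.
Qed.

Section TreeSequence.
Variables (K : Type) (lt : K -> K -> Prop) (lt_wo : strict_well_order lt).
Implicit Types (x y z b : K -> bool) (g d : K) (t : set (K -> bool)).
Local Notation dsep := (dsep lt).
Local Notation agree := (agree lt).
Local Notation Dset := (Dset lt).
Local Notation tree_family := (tree_family lt).

Lemma finite_max (L : set K) : finite_set L -> L !=set0 ->
  exists g, L g /\ forall d, L d -> lt d g \/ d = g.
Proof.
have [_ tr tri] := lt_wo.
move: L; apply: finite_set_rect => [[]//|g L fL gL IH _].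
have [/IH [h [Lh H]]|N] := pselect (L !=set0); last first.
  by exists g; split; [left|move=> d [->|Ld]; [right|case: N; exists d]].
case: (tri g h) => [gh|gh|hg].
- by exists h; split; [right|move=> d [->|/H]; [left|]].
- by rewrite -gh in Lh.
- exists g; split; first by left.
  by move=> d [->|/H [dh|->]]; [right|left; apply: tr dh hg|left].
Qed.

Lemma Dset_tree_family (F : Family K) b t : hereditary F -> F set0 -> tree_family F t ->
  fjoin F (@subsets_le K 1) (Dset b t).
Proof.
move=> hF F0 [ft Ft].
have hJ : hereditary (fjoin F (@subsets_le K 1)).
  by apply: hereditary_join => //; case: (hcompact_subsets_le K 1).
have [D0|N] := pselect (Dset b t !=set0); last first.
  rewrite (_ : Dset b t = set0); last by apply/seteqP; split=> // g Dg; apply: N; exists g.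
  by exists set0 => //; exists set0; [exact: subsets_le_set0|rewrite setU0].
have [g [[y0 ty0 by0] gmax]] := finite_max (Dset_finite lt_wo b ft) D0.
apply: (hJ (Dset y0 t `|` [set g])).
  by exists (Dset y0 t); [exact: Ft|exists [set g] => //; apply/subsets_le1P; right; exists g].
move=> d Dd; have [y ty byd] := Dd; have [dg|->] := gmax d Dd; last by right.
left; exists y => //; apply: dsep_sym; apply: dsep_agree_dsep (dsep_sym byd) _.
exact: (dsep_agree lt_wo by0 dg).
Qed.

(** A branch of [s] sees the set [t] from outside, which costs at most one more level than a member
    of [G]; symmetrically for [t]. *)
Lemma tree_family_join (F G : Family K) : hcompact F -> hcompact G ->
  fjoin (tree_family F) (tree_family G) `<=` tree_family (fjoin (fjoin F G) (@subsets_le K 1)).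
Proof.
move=> [hF _ F0] [hG _ G0] _ [s [fs Fs] [t [ft Gt] <-]]; split; first by rewrite finite_setU.
have DU z : Dset z (s `|` t) = Dset z s `|` Dset z t.
  apply/seteqP; split=> [g [y [sy|ty] yg]|g [[y sy yg]|[y ty yg]]].
  - by left; exists y.
  - by right; exists y.
  - by exists y => //; left.
  - by exists y => //; right.
move=> z [sz|tz]; rewrite DU.
  have [u Gu [v v1 <-]] := Dset_tree_family z hG G0 (conj ft Gt).
  exists (Dset z s `|` u); last by exists v => //; rewrite setUA.
  by exists (Dset z s); [exact: Fs|exists u].
have [u Fu [v v1 <-]] := Dset_tree_family z hF F0 (conj fs Fs).
exists (u `|` Dset z t); last by exists v => //; rewrite setUAC.
by exists u => //; exists (Dset z t) => //; exact: Gt.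
Qed.

(** * The tree of nodes met by almost all terms of a sequence *)

Section Limit.
Variables (F : Family K) (hcF : hcompact F).
Variables (s : nat -> set (K -> bool)) (sF : forall n, tree_family F (s n)).
Variables (U : set_system nat) (UU : UltraFilter U) (Ueventually : eventually `<=` U).

(* The node of [x] at level [g] is met by almost all the [s n]. *)
Definition large_node x g := U [set n | exists2 y, s n y & agree x y g].

(* [e] is a maximal branch of the tree of large nodes, continued by [false]. *)
Definition limit_branch (e : K -> bool) := forall g, large_node e g \/
  (e g = false /\ forall x, (forall d, lt d g -> x d = e d) -> ~ large_node x g).

Lemma large_node_agree x y g : agree x y g -> large_node x g -> large_node y g.
Proof.
move=> xy; apply: filterS => n [z sz xz]; exists z => //.
by move=> d dg; rewrite -xy // xz.
Qed.

Lemma large_node_lt x g d : lt d g -> large_node x g -> large_node x d.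
Proof.
move=> dg; apply: filterS => n [y sy xy]; exists y => //; exact: (agree_lt lt_wo dg xy).
Qed.

(** Follow [z] up to [g]. Above [g], define the branch by well-founded recursion, turning to [true]
    exactly when that node is large. *)
Lemma limit_branch_exists z g : large_node z g -> exists2 e, limit_branch e & agree z e g.
Proof.
move=> zg; have [wf tr tri] := lt_wo.
pose next k (rec : forall d, lt d k -> bool) : bool :=
  if `[< lt g k >] then
    `[< U [set n | exists2 y, s n y & (forall d (dk : lt d k), y d = rec d dk) /\ y k = true] >]
  else z k.
pose e := Fix wf (fun _ => bool) next.
have eE k : e k = next k (fun d _ => e d).
  rewrite /e Fix_eq // => a f h fh; congr next.
  by apply: functional_extensionality_dep => d; apply: functional_extensionality_dep => da.
have ez : agree z e g.
  move=> d dg; rewrite eE /next; case: asboolP => // gd.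
  case: dg => [dg|dg]; last by rewrite dg in gd; case: (lt_irr lt_wo gd).
  by case: (lt_irr lt_wo (tr _ _ _ dg gd)).
exists e => // k.
have [kg|gk] : (lt k g \/ k = g) \/ lt g k by case: (tri k g); [left; left|left; right|right].
  left; apply: (@large_node_agree z) => [d dk|].
    by apply: ez; case: kg dk => [kg [dk|->]|-> //]; [left; apply: tr dk kg|left].
  by case: kg => [/large_node_lt|->//]; apply.
pose Q := U [set n | exists2 y, s n y & (forall d, lt d k -> y d = e d) /\ y k = true].
have ekE : e k = `[<Q>].
  by rewrite eE /next; case: asboolP => [_|//]; congr asbool.
have [ek|nek] := pselect (large_node e k); [by left|right].
have nQ : ~ Q.
  move=> HQ; apply: nek; move: (HQ); apply: filterS => n [y sy [yd yk]].
  exists y => // d [dk|->]; first by rewrite yd.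
  by rewrite yk ekE; apply/asboolP.
have ekf : e k = false by rewrite ekE; apply/asboolP.
split=> // x xe xk; case xkE : (x k).
  apply: nQ; move: xk; apply: filterS => n [y sy xy]; exists y => //.
  by split=> [d dk|]; rewrite -xy ?xkE //; [exact: xe|left|right].
apply: nek; apply: large_node_agree xk => d [dk|->]; first exact: xe.
by rewrite xkE ekf.
Qed.

(** If the node of [e] at [g] were not large, both branches would take the value [false] there. *)
Lemma limit_branch_dsep e e' g : limit_branch e -> limit_branch e' -> dsep e e' g -> large_node e g.
Proof.
move=> le le' [ne H]; case: (le g) => // -[ef N]; case: (le' g) => [e'g|[e'f _]].
  by case: (N e') => // d /H.
by case: ne; rewrite ef e'f.
Qed.

(** In a comb of limit branches the nodes at the splitting levels are large, so a single [s n] meets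
    any finite number of them. A member of it near [e m] then sees all levels below [d m], contrary
    to the compactness of [F]. *)
Lemma limit_branch_finite : finite_set limit_branch.
Proof.
apply: contrapT => iE; have [e [d [le ed dd]]] := comb_exists lt_wo iE.
have [hF _ _] := hcF.
have iD : infinite_set (range d).
  by apply: infinite_image infinite_nat => m n _ _; apply: (level_inj lt_wo dd).
apply: (hcompact_no_infinite hcF iD) => u fu ud.
pose t := d @^-1` u.
have ft : finite_set t by apply: finite_preimage fu => m n _ _; apply: (level_inj lt_wo dd).
have [m tm] := finite_nat_bound ft.
have Uk k : U [set n | forall j, j < k -> exists2 y, s n y & agree (e j) y (d j)].
  elim: k => [|k IH]; first by apply: filterS filterT.
  have ek : large_node (e k) (d k) by apply: limit_branch_dsep (le k.+1) (ed k k.+1 (ltnSn k)).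
  apply: filterS (filterI IH ek) => n [H1 H2] j; rewrite ltnS leq_eqVlt => /orP [/eqP ->//|].
  exact: H1.
have [n Hn] := @filter_ex _ U _ _ (Uk m.+1).
have [y sy ey] := Hn m (ltnSn m).
have [_ /(_ y sy) Fy] := sF n; apply: hF Fy _ => g ug.
have [j _ dj] := ud g ug; have jm : j < m by apply: tm; rewrite /t /= dj.
have [w sw ew] := Hn j (ltnW jm); exists w => //; rewrite -dj.
apply: dsep_agree_dsep (ew); apply: dsep_sym; apply: dsep_agree_dsep (ed j m jm) _.
exact: (agree_lt lt_wo (dd j m jm) ey).
Qed.

(** For each of the finitely many [z] in [s n], almost all [s m] avoid the first node of [z] that is
    not large, and thereby all higher nodes of [z]. *)
Lemma large_avoid n : U [set m | forall z y g, s n z -> s m y -> agree z y g -> large_node z g].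
Proof.
have [+ _] := sF n; move: (s n); apply: finite_set_rect => [|z t _ _ IH].
  by apply: filterS filterT => m _ z y g [].
suff Uz : U [set m | forall y g, s m y -> agree z y g -> large_node z g].
  by apply: filterS (filterI Uz IH) => m [H1 H2] z' y g [->|]; [exact: H1|exact: H2].
have [|N] := pselect (exists g, ~ large_node z g); last first.
  by apply: filterS filterT => m _ y g _ _; apply: contrapT => zg; apply: N; exists g.
move=> /(lt_min lt_wo) [g [nzg H]].
have [//|U'] := @in_ultra_setVsetC _ U [set n | exists2 y, s n y & agree z y g] UU.
apply: filterS U' => m nm y d sy zy; have [_ tr tri] := lt_wo.
case: (tri d g) => [dg|dg|gd]; first by apply: contrapT; apply: H.
  by case: nm; exists y => //; rewrite -dg.
by case: nm; exists y => //; exact: (agree_lt lt_wo gd zy).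
Qed.

(** Indices are picked from a decreasing sequence of members of [U], each cut down to larger indices
    whose sets meet the last picked one only along large nodes. *)
Lemma thinning : exists2 f, increasing_nat f &
  forall m n z y g, m <> n -> s (f m) z -> s (f n) y -> agree z y g -> large_node z g.
Proof.
pose av n := [set m | forall z y g, s n z -> s m y -> agree z y g -> large_node z g].
have Ugt n : U [set m | n < m] by apply: Ueventually; exists n.+1.
have /choice [pick pickP] : forall A : set nat, exists n, U A -> A n.
  move=> A; have [/filter_ex [n An]|nU] := pselect (U A); first by exists n.
  by exists 0.
pose A n := iter n (fun A => A `&` (av (pick A) `&` [set m | pick A < m])) setT.
have UA n : U (A n).
  elim: n => [|n IH]; first exact: filterT.
  apply: filterI IH _; apply: filterI (Ugt _); exact: large_avoid.
have Amono m n : m <= n -> A n `<=` A m.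
  elim: n => [|n IH]; first by rewrite leqn0 => /eqP ->.
  rewrite leq_eqVlt => /orP [/eqP ->//|/IH H]; apply: subset_trans H.
  exact: subIsetl.
have pA m n : m < n -> av (pick (A m)) (pick (A n)) /\ pick (A m) < pick (A n).
  by move=> mn; have [_ []] := Amono m.+1 n mn _ (pickP _ (UA n)).
exists (fun n => pick (A n)) => [m n /pA []//|m n z y g mn sz sy zy].
have [lt1|lt1|//] := ltngtP m n; first by have [H _] := pA _ _ lt1; apply: H zy.
by apply: large_node_agree (agree_sym zy) _; have [H _] := pA _ _ lt1; apply: H (agree_sym zy).
Qed.

(** If [z] is not a limit branch, let [b] be one that splits from it at the highest level [h]. Below
    [h] the branches [z] and [b] split alike, the level [h] goes into [B], and at or above [h] no
    node of [z] is large. *)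
Lemma limit_branch_split z : exists (B : set K) (b : K -> bool),
  @subsets_le K 1 B /\ forall y g, dsep z y g -> (forall d, agree z y d -> large_node z d) ->
    B g \/ (limit_branch b /\ dsep b y g).
Proof.
have [_ tr tri] := lt_wo.
have [lz|nlz] := pselect (limit_branch z).
  by exists set0, z; split; [exact: subsets_le_set0|right].
pose L := [set g | exists2 e, limit_branch e & dsep z e g].
have fL : finite_set L := Dset_finite lt_wo z limit_branch_finite.
have above g d : large_node z d -> (forall h, L h -> lt h g \/ h = g) -> lt d g.
  move=> zd gmax; have [e le ze] := limit_branch_exists zd.
  have [h zh] : exists h, dsep z e h by apply: (dsep_exists lt_wo) => ze'; apply: nlz; rewrite ze'.
  have dh := agree_dsep lt_wo ze zh.
  by case: (gmax h) => [|hg|<-//]; [exists e|exact: tr dh hg].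
have [L0|N] := pselect (L !=set0); last first.
  (* No limit branch exists here, so no node of [z] is large and [z] can split only at the bottom
     level. *)
  exists [set g | forall d, ~ lt d g], z; split.
    have [[g gm]|N'] := pselect (exists g, forall d, ~ lt d g).
      apply/subsets_le1P; right; exists g; apply/seteqP; split=> [h hm|_ -> //].
      by case: (tri h g) => // [/gm|/hm].
    by apply/subsets_le1P; left; apply/seteqP; split=> // g gm; apply: N'; exists g.
  move=> y g zy H; left => d dg; have zd := H d (dsep_agree lt_wo zy dg).
  by apply: (lt_irr lt_wo (above d d zd _)) => h Lh; case: N; exists h.
have [h [[b lb zb] hmax]] := finite_max fL L0.
exists [set h], b; split; first by apply/subsets_le1P; right; exists h.
move=> y g zy H; case: (tri g h) => [gh|gh|hg]; [right|by left|].
  split=> //; apply: dsep_sym; apply: dsep_agree_dsep (dsep_sym zy) _.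
  exact: (dsep_agree lt_wo zb gh).
have zh := H h (dsep_agree lt_wo zy hg).
by case: (lt_irr lt_wo (above h h zh hmax)).
Qed.

End Limit.

(** Subsequences are extracted for one branch after another; those found earlier survive because [H]
    is stable under increasing maps. *)
Lemma simultaneous_subsequence (H : Family nat) (F1 G : Family K) (E : set (K -> bool))
    (v : (K -> bool) -> nat -> set K) :
  spreading H -> finitary H -> finite_set E ->
  (forall u : nat -> set K, (forall n, F1 (u n)) -> exists2 f, increasing_nat f &
     forall X : set nat, H X -> G (\bigcup_(n in X) u (f n))) ->
  (forall b n, F1 (v b n)) ->
  exists2 f, increasing_nat f & forall b (X : set nat), E b -> H X -> G (\bigcup_(n in X) v b (f n)).
Proof.
move=> sH fH fE mult vF; move: E fE; apply: finite_set_rect => [|b E _ _ [f fi fP]].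
  by exists id.
have [h hi hP] := mult (fun n => v b (f n)) (fun n => vF b (f n)).
exists (f \o h); first exact: increasing_nat_comp.
move=> c x [->|Ec] Hx; first exact: hP.
have -> : \bigcup_(n in x) v c ((f \o h) n) = \bigcup_(n in h @` x) v c (f n).
  by rewrite bigcup_image.
by apply: fP => //; apply: spreading_image => //; apply: fH.
Qed.

Lemma tree_family_mult (F G : Family K) (H : Family nat) (s : nat -> set (K -> bool)) :
  hcompact F -> hcompact G -> spreading H -> finitary H ->
  (forall u : nat -> set K, (forall n, fjoin F (@subsets_le K 1) (u n)) ->
     exists2 f, increasing_nat f & forall X : set nat, H X -> G (\bigcup_(n in X) u (f n))) ->
  (forall n, tree_family F (s n)) ->
  exists2 f, increasing_nat f & forall X : set nat, H X ->
    tree_family (fjoin (fjoin F (@subsets_le K 1)) G) (\bigcup_(n in X) s (f n)).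
Proof.
move=> hcF hcG sH fH mult sF.
have [hF _ F0] := hcF; have [hG _ G0] := hcG.
have [U [UU Uev]] := @ultraFilterLemma nat eventually eventually_filter.
have [f fi thin] := thinning sF UU Uev.
have fE := limit_branch_finite hcF sF UU.
have [|h hi hP] := simultaneous_subsequence (v := fun b n => Dset b (s (f n))) sH fH fE mult.
  by move=> b n; apply: Dset_tree_family.
exists (f \o h) => [|X Hx]; first exact: increasing_nat_comp.
split; first by apply: bigcup_finite => [|n _]; [exact: fH|case: (sF (f (h n)))].
move=> z [m xm sz].
have [B [b [B1 bP]]] := limit_branch_split hcF sF UU z.
have hJ : hereditary (fjoin (fjoin F (@subsets_le K 1)) G).
  by do 2?[apply: hereditary_join => //]; case: (hcompact_subsets_le K 1).
(* The guard empties [V] when [b] is only a placeholder, outside the set for which the subsequence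
   was chosen. *)
pose V := [set g | limit_branch s U b /\ (\bigcup_(n in X) Dset b (s (f (h n)))) g].
apply: (hJ ((Dset z (s (f (h m))) `|` B) `|` V)).
  exists (Dset z (s (f (h m))) `|` B).
    exists (Dset z (s (f (h m)))); first by case: (sF (f (h m))) => _; apply.
    by exists B.
  exists V => //; have [lb|nlb] := pselect (limit_branch s U b).
    by apply: hG (hP b X lb Hx) _ => g [].
  by apply: hG G0 _ => g [].
move=> g [y [n xn sy] zy].
have [e|mn] := pselect (m = n); first by left; left; exists y => //; rewrite e.
have [|Bg|[lb by']] := bP y g zy; [|by left; right|].
  by move=> d; apply: thin sz sy => /(increasing_nat_inj hi).
by right; split=> //; exists n => //; exists y.
Qed.

End TreeSequence.

(** * Spreading families on the integers *)

Lemma infinite_nat_above (C : set nat) N : infinite_set C -> infinite_set [set n | C n /\ N < n].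
Proof.
move=> iC; apply: sub_infinite_set (infinite_setDfin iC (finite_II N.+1)) => n [Cn nN].
by split=> //; rewrite ltnNge; apply/negP => H; apply: nN; rewrite /= ltnS.
Qed.

(** If all finite subsets of an infinite [X] were in [F], the part of [X] above a point [x] would be
    equally bad for the section at [x]. *)
Lemma uniform_no_infinite a M (F : Family nat) : uniform_on a M F -> no_infinite F.
Proof.
have key (M' : set nat) (F' : Family nat) : family_on M' F' ->
    (forall n, M' n -> no_infinite (fsection F' n)) -> no_infinite F'.
  move=> [_ _ FM] IH X iX XF.
  have [x Xx] := infinite_nonempty iX; have Fx := XF [set x] (finite_set1 x).
  have {}Fx : F' [set x] by apply: Fx => y ->.
  have := IH x (FM _ Fx x erefl) _ (infinite_nat_above (N := x) iX); apply=> s fs sX.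
  split; first by move=> m /sX [].
  by apply: XF => [|y [->//|/sX []//]]; apply: finite_setU1.
elim=> {a M F} [a M F fam _ F0 X iX XF|a b M F fam _ _ _ IH|a c M F fam _ _ _ _ _ _ IH].
- have [x Xx] := infinite_nonempty iX.
  have : F [set x] by apply: XF => [|y ->//]; apply: finite_set1.
  by rewrite F0 => /seteqP [/(_ x erefl)].
- exact: key fam IH.
- exact: key fam IH.
Qed.

Lemma frakS_hcompact H : frakS H -> hcompact H.
Proof.
move=> [hH _ [a [_ uH]]]; have [fH H0] : finitary H /\ H set0.
  by case: uH => [a' M F [_ fF _] _ F0|a' b M F [_ fF _]|a' c M F [_ fF _]] //; split=> //; rewrite F0.
by apply: hcompactP => //; apply: uniform_no_infinite uH.
Qed.

(** A single member with more than [k] elements spreads to every set of [k.+1] integers beyond its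
    element [N] of rank [k.+1], and every infinite [C] contains enough of these. *)
Lemma spreading_srk (H : Family nat) s k : hcompact H -> spreading H -> H s ->
  ~ (s #<= `I_k) -> ofin k.+1 <=o srk H.
Proof.
move=> hcH sH Hs nk; have [hH [fH _] _] := hcH.
have s0 : s !=set0.
  apply: contrapT => N; apply: nk; rewrite (_ : s = set0); first exact: card_ge0.
  by apply/seteqP; split=> // n sn; apply: N; exists n.
have [q [m [mi ms]]] := finite_nat_enum (fH s Hs) s0.
have kq : k <= q.
  rewrite leqNgt; apply/negP => qk; apply: nk.
  apply: card_le_trans (_ : _ #<= `I_q.+1) _; last by rewrite card_le_II.
  rewrite -ms; apply: card_le_trans (card_image_le _ _) _.
  by rewrite -(card_le_eql card_II) card_lexx.
have kq1 : k.+1 <= q.+1 by [].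
pose m' (i : 'I_k.+1) := m (widen_ord kq1 i).
have m'i (i j : 'I_k.+1) : i < j -> m' i < m' j by move=> ij; apply: mi.
have Hm' : H (range m') by apply: hH Hs _ => _ [i _ <-]; rewrite -ms; exists (widen_ord kq1 i).
pose N := m' ord_max.
have m'N i : m' i <= N.
  have := leq_ord i; rewrite leq_eqVlt => /orP [/eqP ik|ik]; last by apply: ltnW; apply: m'i.
  by rewrite (_ : i = ord_max) //; apply: val_inj.
apply: (srk_ge infinite_nat) => C iC.
have hcC := hcompact_frestrict C hcH; have [hC _ _] := hcC.
apply/(dv_rk hcC).
have key j (l : seq nat) : sorted ltn l -> size l + j = k.+1 ->
    (forall i, i \in l -> C i /\ N < i) -> dv (frestrict H C) (ofin j) [set` l].
  elim: j l => [|j IH] l ls lk lC.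
    rewrite addn0 in lk; apply/dv0; split; last by move=> i /lC [].
    have -> : [set` l] = range (fun i : 'I_k.+1 => nth 0 l i).
      apply/seteqP; split=> [i /= il|_ [i _ <-]]; last by apply: mem_nth; rewrite lk.
      have il' : index i l < k.+1 by rewrite -lk index_mem.
      by exists (Ordinal il') => //; rewrite nth_index.
    apply: (sH k m') => // i.
      by move=> j ij; apply: (sorted_ltn_nth ltn_trans 0 ls) => //; rewrite inE lk.
    have il : nth 0 l i \in l by apply: mem_nth; rewrite lk.
    by have [_ /ltnW] := lC _ il; apply: leq_trans.
  have [b lb] := finite_nat_bound (finite_seq l).
  have iD := infinite_nat_above (N := maxn N b) iC.
  have ext i : C i -> maxn N b < i -> dv (frestrict H C) (ofin j) (i |` [set` l]).
    rewrite gtn_max => Ci /andP [Ni bi].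
    have -> : i |` [set` l] = [set` rcons l i].
      apply/seteqP; split=> x /=; rewrite mem_rcons inE.
        by case=> [->|->]; rewrite ?eqxx ?orbT.
      by case/orP=> [/eqP|]; [left|right].
    apply: IH.
    - case: l ls lk lC lb => // a l ls lk lC lb; rewrite /= rcons_path; apply/andP; split => //.
      by apply: ltn_trans bi; apply: lb; rewrite /= mem_last.
    - by rewrite size_rcons addSnnS.
    - by move=> x; rewrite mem_rcons inE => /orP [/eqP ->|/lC].
  have [i [Ci iN]] := infinite_nonempty iD.
  apply: dv_succ; first by apply: hC (dvW (ext i Ci iN)) _ => x xl; right.
  apply: sub_infinite_set iD => x [Cx xN]; split; last exact: ext.
  by move=> /lb xb; move: xN; rewrite gtn_max => /andP [_ bx]; rewrite ltnNge ltnW in xb.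
have := key k.+1 [::] isT erefl; rewrite (_ : [set` [::]] = set0); last by apply/seteqP; split.
by apply.
Qed.

Lemma spreading_bounded (H : Family nat) s k : hcompact H -> spreading H ->
  srk H <=o ofin k -> H s -> s #<= `I_k.
Proof.
move=> hcH sH Hk Hs; apply: contrapT => /(spreading_srk hcH sH Hs) lt1.
apply: (@olt_irr (ofin k)); apply/osucc_le; exact: ole_trans lt1 Hk.
Qed.

(** * The basis *)

Lemma oeq_sym a b : a ~=o b -> b ~=o a.
Proof. by case. Qed.

Lemma oeq_trans b a c : a ~=o b -> b ~=o c -> a ~=o c.
Proof. by move=> [ab ba] [bc cb]; split; [apply: ole_trans ab bc|apply: ole_trans cb ba]. Qed.

Lemma omul0l a b : a <=o ozero -> omul a b <=o ozero.
Proof.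
move=> a0; apply: ole_trans (omul_homol b a0) _.
elim: b => B g IH; apply/osup_le => j; apply: ole_trans (oadd0 _).1 _; exact: IH.
Qed.

Lemma omul_ge_l a b : oone <=o b -> a <=o omul a b.
Proof. by move=> b1; apply: ole_trans (omul1 a).2 (omul_homo a b1). Qed.

Lemma omul_ge_r a b : oone <=o a -> b <=o omul a b.
Proof. by move=> a1; apply: ole_trans (mul1o b) (omul_homol b a1). Qed.

Lemma omega_lt_iota a : omega <o iota_ord a -> omega <=o a.
Proof. by move=> wi; apply/oleNgt => /iota_ord_fin [/oleNgt]. Qed.

(** For nonzero [h], an exp-indecomposable ordinal above the product exceeds both [h] and [a], hence
    also [a']. For [h] zero both products vanish. *)
Lemma iota_ord_mul a a' h : oone <=o a -> oone <=o a' ->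
  a <o iota_ord a -> a' <o iota_ord a' -> iota_ord a ~=o iota_ord a' ->
  iota_ord (omul a h) = iota_ord (omul a' h).
Proof.
have key b b' m : oone <=o b -> b <o iota_ord b -> b' <o iota_ord b' ->
    iota_ord b ~=o iota_ord b' -> exp_indecomposable m -> omul b h <o m -> omul b' h <o m.
  move=> b1 bi bi' e mE bh.
  have [h1|/olt_oone h0] := ole_total oone h.
    have [_ _ least] := iota_ord_ltP bi.
    have bm : b <o m := ole_lt_trans (omul_ge_l b h1) bh.
    apply: exp_indecomposable_mul => //; last exact: ole_lt_trans (omul_ge_r h b1) bh.
    exact: olt_le_trans bi' (ole_trans e.2 (least m mE bm)).
  apply: ole_lt_trans (exp_indecomposable_gt0 mE).
  by apply: ole_trans (omul_homo b' h0) (omul0 b').1.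
move=> a1 a'1 ai a'i e; apply: iota_ord_eq => m mE.
by split; apply: key => //; apply: oeq_sym.
Qed.

Lemma bigcup_subsets_le (I : Type) (s : nat -> set I) n k (x : set nat) :
  (forall i, subsets_le I n (s i)) -> subsets_le nat k x ->
  subsets_le I (k * n) (\bigcup_(i in x) s i).
Proof.
elim/Pchoice: I => I in s *; move=> sn /subsets_leP [l lk xl].
suff [l' l'n sl'] : exists2 l' : seq I, size l' <= size l * n & \bigcup_(i in [set` l]) s i `<=` [set` l'].
  apply/subsets_leP; exists l'; first by apply: leq_trans l'n _; rewrite leq_mul2r lk orbT.
  by move=> y [i /xl il sy]; apply: sl'; exists i.
elim: l {lk xl} => [|i l [l' l'n sl']]; first by exists [::] => // y [].
have /subsets_leP [t tn st] := sn i.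
exists (t ++ l'); first by rewrite size_cat mulSn leq_add.
move=> y [j /=]; rewrite inE mem_cat => /orP [/eqP ->|jl] sy; first by rewrite (st y sy).
by rewrite (sl' y) ?orbT //; exists j.
Qed.

Lemma fjoinC (I : Type) (F G : Family I) : fjoin F G = fjoin G F.
Proof.
by apply/seteqP; split=> _ [s Fs [t Gt <-]]; exists t => //; exists s => //; rewrite setUC.
Qed.

Section Basis.
Variables (K : Type) (infK : infinite_set [set: K]).
Variables (lt : K -> K -> Prop) (lt_wo : strict_well_order lt).
Variables (B : set (Family K)) (times : Family K -> Family nat -> Family K).
Hypothesis BP : is_basis B times.
Local Notation tree_family := (tree_family lt).
Local Notation T := (K -> bool).

Let infT : infinite_set [set: T] := infinite_branches infK.

(* Families of finite rank need a separate clause: [tree_family F] need not be homogeneous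
   when [srk F] is finite and [F] has arbitrarily large members. *)
Definition tree_basis : set (Family T) := [set G | homogeneous G /\
  ((exists n, G `<=` @subsets_le T n) \/
   (exists F, [/\ B F, omega <=o srk F, iota_ord (srk F) ~=o iota_ord (srk G) & G `<=` tree_family F]))].

Lemma basis_hcompact F : B F -> hcompact F.
Proof. by move=> /(basis_homogeneous BP) /homogeneous_hcompact. Qed.

Lemma basis_iota F : B F -> [/\ exp_indecomposable (iota_ord (srk F)), rk F <o iota_ord (srk F) &
  forall m, exp_indecomposable m -> srk F <o m -> iota_ord (srk F) <=o m].
Proof. by move=> /(basis_homogeneous BP); apply: homogeneous_iota. Qed.

Lemma subsets_le_tree_family n : @subsets_le T n `<=` tree_family (@subsets_le K n).
Proof.
move=> s sn; split; first by apply/finite_set_leP; exists n.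
by move=> z _; apply: card_le_trans (Dset_card lt_wo z s) sn.
Qed.

(** The join has small rank at least [a] because of [F'], and rank below [iota_ord a] by the natural
    sum bound. *)
Lemma basis_join_iota F F' a : B F -> B F' -> omega <o iota_ord a -> a <=o srk F' ->
  rk F <o iota_ord a -> rk F' <o iota_ord a ->
  [/\ B (fjoin F F'), omega <=o srk (fjoin F F'), rk (fjoin F F') <o iota_ord a &
      iota_ord (srk (fjoin F F')) ~=o iota_ord a].
Proof.
move=> BF BF' wa aF' Fa F'a; have BJ := basis_join BP BF BF'.
have [aE _ _] := iota_ord_ltP wa.
have hF := basis_hcompact BF; have hF' := basis_hcompact BF'; have hJ := basis_hcompact BJ.
have Ja : rk (fjoin F F') <o iota_ord a by apply: rk_join_lt.
have [_ _ F0] := hF.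
have e : iota_ord (srk (fjoin F F')) ~=o iota_ord a.
  have sJ : a <=o srk (fjoin F F').
    by apply: ole_trans aF' _; apply: srk_homo => //; apply: fjoin_subr.
  have [_ Js _] := basis_iota BJ.
  have [_ _ least] := iota_ord_ltP (ole_lt_trans (srk_rk infK _) Js).
  have [_ _ leasta] := iota_ord_ltP Ja.
  have [JE Jr _] := basis_iota BJ.
  split; first by apply: least => //; apply: ole_lt_trans (srk_rk infK _) Ja.
  by apply: leasta => //; apply: ole_lt_trans sJ (ole_lt_trans (srk_rk infK _) Jr).
by split=> //; apply: omega_lt_iota; apply: olt_le_trans wa e.2.
Qed.

(** Here [F2] dominates. The lift of [J], the join of [F1], [F2] and the sets of size at most 1,
    contains [G], and [J] still has the [iota_ord] of [F2]. *)
Lemma tree_basis_sandwich_inf G1 G2 G F1 F2 : homogeneous G2 -> hcompact G ->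
  G2 `<=` G -> G `<=` fjoin G1 G2 -> B F1 -> G1 `<=` tree_family F1 ->
  B F2 -> G2 `<=` tree_family F2 -> omega <=o srk F2 ->
  iota_ord (srk F2) ~=o iota_ord (srk G2) -> rk F1 <o iota_ord (srk F2) ->
  tree_basis G.
Proof.
move=> hom2 hcG G2G GJ BF1 GF1 BF2 GF2 wF2 e2 F12.
have [E2 r2 _] := basis_iota BF2.
have w2 : omega <o iota_ord (srk F2).
  exact: ole_lt_trans wF2 (ole_lt_trans (srk_rk infK F2) r2).
have hF1 := basis_hcompact BF1; have hF2 := basis_hcompact BF2.
have [BJ0 _ rJ0 _] := basis_join_iota BF1 BF2 w2 (ole_refl _) F12 r2.
set J0 := fjoin F1 F2 in BJ0 rJ0.
have hJ0 := basis_hcompact BJ0.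
pose J := fjoin (@subsets_le K 1) J0.
have r1 : rk (@subsets_le K 1) <o iota_ord (srk F2).
  apply: ole_lt_trans (rk_subsets_le K 1) (olt_trans _ w2); exact: ofin_lt_omega.
have sJ0 : srk F2 <=o srk J0.
  by apply: srk_homo => //; apply: fjoin_subr; case: hF1.
have [BJ wJ rJ eJ] := basis_join_iota (basis_subsets_le BP 1) BJ0 w2 sJ0 r1 rJ0.
have GtJ : G `<=` tree_family J.
  rewrite /J fjoinC; apply: subset_trans GJ _.
  by apply: subset_trans (fjoin_homo GF1 GF2) _; apply: tree_family_join.
have hJ := basis_hcompact BJ.
have hc2 := homogeneous_hcompact hom2.
have sub1 : @subsets_le T 1 `<=` G.
  have [G20|[sub1 _]] := homogeneous_cases infT hom2; last exact: subset_trans sub1 G2G.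
  (* The trivial family has [iota_ord] equal to [omega], whereas that of [G2] is larger. *)
  have : omega <o omega; last by move/olt_irr.
  apply: olt_le_trans w2 (ole_trans e2.1 (iota_ord_fin _).1).
  apply: ole_lt_trans (ofin_lt_omega 0).
  by apply: srk_fin => //; rewrite subsets_le0 G20.
have [homG eG] : homogeneous G /\ iota_ord (srk G) ~=o iota_ord (srk G2).
  apply: homogeneous_crit => //; first exact: srk_homo.
  apply: olt_le_trans e2.1.
  apply: ole_lt_trans (rk_tree_family lt_wo hJ E2 w2 rJ).
  by apply: rk_homo => //; apply: tree_family_hcompact.
split=> //; right; exists J; split=> //.
exact: oeq_trans eJ (oeq_trans e2 (oeq_sym eG)).
Qed.

(** The union and the join both lie between the two families and their join, so this gives both
    closure properties. *)
Lemma tree_basis_sandwich G1 G2 G : tree_basis G1 -> tree_basis G2 -> hcompact G ->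
  G1 `<=` G -> G2 `<=` G -> G `<=` fjoin G1 G2 -> tree_basis G.
Proof.
move=> [hom1 H1] [hom2 H2] hcG G1G G2G GJ.
have fin_inf n G' F' : G' `<=` @subsets_le T n -> B F' -> omega <=o srk F' ->
    rk (@subsets_le K n) <o iota_ord (srk F') /\ G' `<=` tree_family (@subsets_le K n).
  move=> Gn BF' wF'; split; last exact: subset_trans Gn (@subsets_le_tree_family n).
  have [_ r' _] := basis_iota BF'.
  apply: ole_lt_trans (rk_subsets_le K n) _; apply: olt_trans (ofin_lt_omega n) _.
  exact: ole_lt_trans wF' (ole_lt_trans (srk_rk infK _) r').
case: H1 => [[n1 Gn1]|[F1 [BF1 w1 e1 GF1]]]; case: H2 => [[n2 Gn2]|[F2 [BF2 w2 e2 GF2]]].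
- have Gn : G `<=` @subsets_le T (n1 + n2).
    apply: subset_trans GJ _.
    exact: subset_trans (fjoin_homo Gn1 Gn2) (@subsets_le_join _ _ _).
  split; last by left; exists (n1 + n2).
  have [G10|[sub1 _]] := homogeneous_cases infT hom1; last first.
    by apply: homogeneous_fin Gn _ => //; apply: subset_trans sub1 G1G.
  have [G20|[sub1 _]] := homogeneous_cases infT hom2; last first.
    by apply: homogeneous_fin Gn _ => //; apply: subset_trans sub1 G2G.
  have -> : G = @subsets_le T 0.
    rewrite subsets_le0; apply/seteqP; split=> [s /GJ|s ->]; last by case: hcG.
    by rewrite G10 G20 => -[_ -> [_ -> <-]]; rewrite /= setU0.
  exact: homogeneous_subsets_le.
- have [r1 GF1] := fin_inf n1 G1 F2 Gn1 BF2 w2.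
  exact: (tree_basis_sandwich_inf hom2 hcG G2G GJ (basis_subsets_le BP n1) GF1 BF2 GF2 w2 e2 r1).
- have [r2 GF2] := fin_inf n2 G2 F1 Gn2 BF1 w1; rewrite fjoinC in GJ.
  exact: (tree_basis_sandwich_inf hom1 hcG G1G GJ (basis_subsets_le BP n2) GF2 BF1 GF1 w1 e1 r2).
- have [_ r1 _] := basis_iota BF1; have [_ r2 _] := basis_iota BF2.
  have [le12|/oltW le21] := ole_total (iota_ord (srk F1)) (iota_ord (srk F2)).
    exact: (tree_basis_sandwich_inf hom2 hcG G2G GJ BF1 GF1 BF2 GF2 w2 e2 (olt_le_trans r1 le12)).
  rewrite fjoinC in GJ.
  exact: (tree_basis_sandwich_inf hom1 hcG G1G GJ BF2 GF2 BF1 GF1 w1 e1 (olt_le_trans r2 le21)).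
Qed.

Lemma tree_basis_subsets_le n : tree_basis (@subsets_le T n).
Proof. by split; [apply: homogeneous_subsets_le|left; exists n]. Qed.

Lemma tree_basis_hcompact G : tree_basis G -> hcompact G.
Proof. by case=> /homogeneous_hcompact. Qed.

(** The product is the lift of the join of [F1] and [times F1 H]; the extra singletons in [F1] allow
    for the one level lost when a branch outside the sets is considered. The last two hypotheses
    cover a large [F], and a bounded [F] with a large [H]. *)
Lemma tree_basis_mult_inf G F H : tree_basis G -> frakS H -> B F -> G `<=` tree_family F ->
  oone <=o srk G -> oone <=o srk H ->
  iota_ord (srk (fjoin F (@subsets_le K 1))) ~=o iota_ord (srk G) ->
  omega <=o omul (srk (fjoin F (@subsets_le K 1))) (srk H) ->
  exists2 P, tree_basis P & is_multiplication G H P.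
Proof.
move=> [homG _] SH BF GF G1 H1; set F1 := fjoin F _ => eF1 wF1.
have BF1 : B F1 by apply: (basis_join BP) => //; apply: (basis_subsets_le BP).
have BM := basis_times_closed BP BF1 SH; have [homM eM multM] := basis_times BP BF1 SH.
set M := times F1 H in BM homM eM multM.
have hcF := basis_hcompact BF; have hcF1 := basis_hcompact BF1; have hcM := basis_hcompact BM.
have hcH := frakS_hcompact SH; have [hH sH _] := SH; have [_ [fH _] _] := hcH.
have [_ _ F0] := hcF.
have F1s : oone <=o srk F1 by apply: srk_ge1 => //; apply: fjoin_subr.
have [_ rM _] := basis_iota BM; have [_ rF1 leF1] := basis_iota BF1.
have [pE pp _] := iota_ord_ltP (olt_le_trans rM eM.1).
have wM : omega <o iota_ord (srk M).
  exact: olt_le_trans (ole_lt_trans wF1 pp) eM.2.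
have rF1M : rk F1 <o iota_ord (srk M).
  apply: olt_le_trans rF1 (ole_trans _ eM.2); apply: leF1 => //.
  exact: ole_lt_trans (omul_ge_l _ H1) pp.
have [BJ wJ rJ eJ] := basis_join_iota BF1 BM wM (ole_refl _) rF1M rM.
have [homP eP] := tree_family_homogeneous lt_wo infK (basis_homogeneous BP BJ) wJ.
exists (tree_family (fjoin F1 M)).
  by split=> //; right; exists (fjoin F1 M); split=> //; apply: oeq_sym.
have [_ rG _] := homogeneous_iota infT homG.
split=> //.
  rewrite -(iota_ord_mul (srk H) F1s G1) //.
  - exact: oeq_trans eP (oeq_trans eJ eM).
  - exact: ole_lt_trans (srk_rk infK _) rF1.
  - exact: ole_lt_trans (srk_rk infT _) rG.
move=> s sG; have [||f fi fP] := tree_family_mult (s := s) lt_wo hcF hcM sH fH.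
- by move=> u /multM [f [fi fP]]; exists f.
- by move=> n; apply: GF.
by exists f.
Qed.

Lemma tree_basis_mult G H : tree_basis G -> frakS H ->
  exists2 P, tree_basis P & is_multiplication G H P.
Proof.
move=> BG SH; have hcG := tree_basis_hcompact BG; have [homG HG] := BG.
have hcH := frakS_hcompact SH; have [hH sH _] := SH; have [_ [fH _] _] := hcH.
(* When one factor is trivial all unions are empty and the trivial family is a product. *)
have zero : srk G <=o ozero \/ srk H <=o ozero -> (forall s x, (forall n : nat, G (s n)) -> H x ->
    \bigcup_(n in x) s n = set0) -> exists2 P, tree_basis P & is_multiplication G H P.
  move=> GH0 U0; exists (@subsets_le T 0); first exact: tree_basis_subsets_le.
  split; first exact: homogeneous_subsets_le.
    have sP : srk (@subsets_le T 0) <o omega.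
      apply: ole_lt_trans (ofin_lt_omega 0); apply: srk_fin => //.
      exact: hcompact_subsets_le.
    have sGH : omul (srk G) (srk H) <o omega.
      apply: ole_lt_trans (ofin_lt_omega 0); case: GH0 => [/omul0l|H0]; first exact.
      exact: ole_trans (omul_homo _ H0) (omul0 _).1.
    exact: oeq_trans (iota_ord_fin sP) (oeq_sym (iota_ord_fin sGH)).
  move=> s sG; exists id; split=> // x Hx; rewrite (U0 s x) //; exact: subsets_le_set0.
have [G0|[G1 sG1]] := homogeneous_cases infT homG.
  apply: zero => [|s x sG _]; first left.
    by apply: (@srk_fin _ infT _ 0) => //; rewrite subsets_le0 G0.
  by rewrite bigcup0 // => n _; have := sG n; rewrite G0.
have [sH1|/olt_oone H0] := ole_total oone (srk H); last first.
  apply: zero => [|s x sG Hx]; first by right.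
  have : x #<= `I_0 by apply: spreading_bounded Hx.
  by rewrite II0 card_le0 => /eqP ->; rewrite bigcup_set0.
case: HG => [[n Gn]|[F [BF wF eF GF]]]; last first.
  have [FE rF _] := basis_iota BF.
  have wiF : omega <o iota_ord (srk F).
    exact: ole_lt_trans wF (ole_lt_trans (srk_rk infK F) rF).
  have r1 : rk (@subsets_le K 1) <o iota_ord (srk F).
    apply: ole_lt_trans (rk_subsets_le K 1) (olt_trans _ wiF); exact: ofin_lt_omega.
  have [_ wF1 _ eF1] := basis_join_iota (basis_subsets_le BP 1) BF wiF (ole_refl _) r1 rF.
  rewrite fjoinC in wF1 eF1.
  apply: (tree_basis_mult_inf BG SH BF GF sG1 sH1); first exact: oeq_trans eF1 eF.
  exact: ole_trans wF1 (omul_ge_l _ sH1).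
have [wH|Hw] := ole_total omega (srk H).
  have Gt := subset_trans Gn (@subsets_le_tree_family n).
  have BF := basis_subsets_le BP n.
  have BF1 := basis_join BP BF (basis_subsets_le BP 1).
  have hcF1 := basis_hcompact BF1.
  apply: (tree_basis_mult_inf BG SH BF Gt sG1 sH1).
    have s1 : srk (fjoin (@subsets_le K n) (@subsets_le K 1)) <o omega.
      by apply: ole_lt_trans (ofin_lt_omega (n + 1)); apply: srk_fin => //; apply: subsets_le_join.
    have s2 : srk G <o omega.
      by apply: ole_lt_trans (ofin_lt_omega n); apply: srk_fin.
    exact: oeq_trans (iota_ord_fin s1) (oeq_sym (iota_ord_fin s2)).
  apply: ole_trans wH (omul_ge_r _ _); apply: srk_ge1 => //.
  by apply: fjoin_subr; apply: subsets_le_set0.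
have [k Hk] := lt_omega Hw.
(* With both factors finite, a union is over at most [k] indices of sets of size at most [n]. *)
exists (@subsets_le T (k * n)); first exact: tree_basis_subsets_le.
split; first exact: homogeneous_subsets_le.
  have sP : srk (@subsets_le T (k * n)) <o omega.
    apply: ole_lt_trans (ofin_lt_omega (k * n)); apply: srk_fin => //.
    exact: hcompact_subsets_le.
  have sGH : omul (srk G) (srk H) <o omega.
    apply: ole_lt_trans (ofin_lt_omega (n * k)); apply: ole_trans (omul_fin n k).
    by apply: ole_trans (omul_homo _ Hk) (omul_homol _ _); apply: srk_fin.
  exact: oeq_trans (iota_ord_fin sP) (oeq_sym (iota_ord_fin sGH)).
move=> s sG; exists id; split=> // x Hx; apply: bigcup_subsets_le => [i|]; first exact: Gn.
exact: spreading_bounded Hx.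
Qed.

Lemma tree_basis_has_basis : has_basis T.
Proof.
have /choice [times' tP] : forall GH : Family T * Family nat, exists P,
    tree_basis GH.1 -> frakS GH.2 -> tree_basis P /\ is_multiplication GH.1 GH.2 P.
  move=> [G H] /=; have [[BG SH]|N] := pselect (tree_basis G /\ frakS H).
    by have [P BP' mP] := tree_basis_mult BG SH; exists P.
  (* An arbitrary value outside the domain of the multiplication. *)
  by exists G => BG SH; case: N.
exists tree_basis, (fun G H => times' (G, H)); split.
- by move=> G [].
- exact: tree_basis_subsets_le.
- move=> a wa ca; have [F [BF Fa]] := basis_srk BP wa ca.
  have wF : omega <=o srk F := ole_trans wa Fa.2.
  have [homP eP] := tree_family_homogeneous lt_wo infK (basis_homogeneous BP BF) wF.
  have hF := basis_hcompact BF.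
  exists (tree_family F); split.
    by split=> //; right; exists F; split=> //; apply: oeq_sym.
  apply: oeq_trans Fa; split; first exact: srk_tree_family_le.
  exact: srk_tree_family_ge.
- move=> F G BF BG; have hF := tree_basis_hcompact BF; have hG := tree_basis_hcompact BG.
  have [_ _ F0] := hF; have [_ _ G0] := hG.
  have FGJ : F `|` G `<=` fjoin F G.
    by move=> s [Fs|Gs]; [exact: fjoin_subl|exact: fjoin_subr].
  apply: (tree_basis_sandwich BF BG) => //.
  have hU : hereditary (F `|` G).
    move=> s t [Fs|Gs] ts; [left|right].
      by case: hF => h _ _; apply: h ts.
    by case: hG => h _ _; apply: h ts.
  have hJ := hcompact_join hF hG; split=> //; last by left.
  by apply: compact_sub hU _ FGJ _; case: hJ.
- move=> F G BF BG; have hF := tree_basis_hcompact BF; have hG := tree_basis_hcompact BG.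
  apply: (tree_basis_sandwich BF BG) => //; first exact: hcompact_join.
    by apply: fjoin_subl; case: hG.
  by apply: fjoin_subr; case: hF.
- move=> F G FG [_ HG] homF e; split=> //.
  case: HG => [[n Gn]|[F' [BF' wF' e' GF']]]; [left|right].
    by exists n; apply: subset_trans FG Gn.
  exists F'; split=> //; last exact: subset_trans FG GF'.
  exact: oeq_trans e' (oeq_sym e).
- by move=> G H BG SH; case: (tP (G, H) BG SH).
- by move=> G H BG SH; case: (tP (G, H) BG SH).
Qed.

End Basis.

Theorem theorem4p1 (K : Type) (infK : infinite_set [set: K]) :
  has_basis K -> has_basis (K -> bool).
Proof.
move=> [B [times BP]]; have [lt lt_wo] := strict_well_order_exists K.
exact: (tree_basis_has_basis infK lt_wo BP).
Qed.
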